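(* The space $(\bar{\bar X},\bar{\bar d}_2)$ of unordered tree-like shapes with the QED metric is generically non-positively curved. With the TED metric $\bar{\bar d}_1$, however, $\bar{\bar X}$ has everywhere unbounded curvature, geodesics are nowhere locally unique, and neither are means, centroids or circumcenters. The same holds in any restricted space $\bar{\bar Z}\subset\bar{\bar X}$ arising from a restricted pre-shape space $Z\subset X$ that is saturated with respect to the reordering group $G$, with the corresponding metrics on $\bar{\bar Z}$ induced by $d_2$ and $d_1$.
   Context: Setting. Fix integers $d,n\ge 1$ (in the paper $d=2$ or $3$) and a finite rooted ordered (planar) binary tree $\mathscr T=(V,E,r)$ with $E\neq\emptyset$: every non-leaf vertex has exactly two children, and the children of each vertex are totally ordered. The tree pre-shape space is the vector space $X=\prod_{e\in E}(\mathbb R^d)^n$, with elements $x=(x_e)_{e\in E}$. On $X$ consider the metrics $d_1(x,y)=\sum_{e\in E}\|x_e-y_e\|$ and $d_2(x,y)=\sqrt{\sum_{e\in E}\|x_e-y_e\|^2}$, where $\|\cdot\|$ is the Euclidean norm on $(\mathbb R^d)^n$. Equivalence. For $x\in X$, the collapsed tree of $x$ is the rooted ordered tree with edge attributes obtained from $\mathscr T$ by contracting every edge $e$ with $x_e=0$ (when an edge from $u$ down to $v$ is contracted, the children of $v$ are inserted, in order, at the position of $v$ among the children of $u$) and keeping the attribute $x_e$ on each remaining edge. Put $x\sim y$ iff the collapsed trees of $x$ and $y$ are isomorphic as rooted ordered trees with edge attributes. $\bar X=X/\sim$; write $\bar x$ for the class of $x$. Quotient pseudometric. If $(Y,\rho)$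 is a metric space with an equivalence relation $\approx$, the quotient pseudometric on $Y/\approx$ is $$\bar\rho([x],[y])=\inf\Big\{\sum_{i=1}^k \rho(x_i,y_i)\ :\ k\ge 1,\ x_1\in[x],\ y_i\approx x_{i+1}\ (1\le i<k),\ y_k\in[y]\Big\}.$$ $\bar d_1,\bar d_2$ are the quotient (pseudo)metrics on $\bar X$ induced by $d_1,d_2$. Unordered tree-shapes. $G$ is the finite group of reorderings of $\mathscr T$, i.e. of automorphisms of $\mathscr T$ as a rooted tree when the sibling orders are forgotten; it acts on $X$ by permuting the edge coordinates. $\bar{\bar X}=\bar X/G$ is the quotient of $\bar X$ by the equivalence relation generated by $\bar x\approx\overline{g x}$ for $x\in X$, $g\in G$. The TED metric $\bar{\bar d}_1$ and the QED metric $\bar{\bar d}_2$ on $\bar{\bar X}$ are the quotient metrics induced by $\bar d_1$ and $\bar d_2$. Restricted spaces. A subset $E'\subset E$ determines a combinatorial ordered rooted tree (its topology) by contracting in $\mathscr T$ all edges outside $E'$. Let $\mathcal E$ be a nonempty family of subsets of $E$ such that if $E'\in\mathcal E$ and $E''\subset E$ determines the same ordered topology as $E'$, then $E''\in\mathcal E$. The restricted pre-shape space is $Z=\bigcup_{E'\in\mathcal E}\{x\in X: x_e=0\text{ for }e\notin E'\}$, with the metric $d_Z$ induced by $d\in\{d_1,d_2\}$ (the length metric: infimum of $d$-lengths of paths in $Z$); $\bar Z=Z/\sim_Z$ with $\sim_Z$ the restriction of $\sim$, with the quotient metric induced by $d_Z$. $Z$ is saturated with respect to $G$ if for every topology appearing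 in $\mathcal E$, every subset of $E$ whose topology is a reordering of siblings of that topology also lies in $\mathcal E$. Then $\bar{\bar Z}=\bar Z/G$ is the image of $\bar Z$ in $\bar{\bar X}$ (quotient of $\bar Z$ by the restriction of $\approx$), with the quotient metric induced from $\bar Z$. Curvature. A metric space is $CAT(\kappa)$ if it is geodesic (for $\kappa>0$, for pairs of points at distance $<\pi/\sqrt\kappa$) and geodesic triangles (of perimeter $<2\pi/\sqrt\kappa$ if $\kappa>0$) are no thicker than comparison triangles with the same side lengths in the simply connected model surface of constant curvature $\kappa$. A space is non-positively curved at a point if some ball around the point is $CAT(0)$; ''generically non-positively curved'' means that this holds at all points of an open dense subset. Curvature is unbounded at a point if no ball around it is $CAT(\kappa)$ for any $\kappa\in\mathbb R$. Local uniqueness. Geodesics (respectively means, centroids, circumcenters) are locally unique at a point if the point has a sufficiently small neighborhood such that geodesics between any two points of it (respectively means, centroids, circumcenters of datasets contained in it) are unique; ''nowhere'' means this fails at every point. Averages in a metric space $(Y,\rho)$. A mean of a finite set $\{x_1,\dots,x_s\}$ is a minimizer over $x\in Y$ of $\sum_i\rho(x,x_i)^2$. A circumcenter of a nonempty bounded set is the center of a smallest closed ball containing it. The centroid of a finite set $S$ is defined recursively: for $|S|=2$ it is the midpoint of a geodesic joining the two points; for $|S|=m>2$ let $c^1(S)$ be the family of the $m$ centroids of the $(m-1)$-element subfamilies of $S$ and $c^k(S)=c^1(c^{k-1}(S))$; if the elements of $c^k(S)$ converge to one point $c$ as $k\to\infty$, then $c$ is the centroid of $S$.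
   Formalization: For restricted spaces, the TED claims are stated only when some edge subset in the family has at least two edges; otherwise the restricted space is a single point or Euclidean (R^d)^n, where unbounded curvature and non-uniqueness fail. *)

(* Defs.v *)
(* MathComp / MathComp-Analysis. *)
From HB Require Import structures.
From Stdlib Require Import Relation_Operators.
From mathcomp Require Import all_boot all_order all_algebra all_fingroup.
From mathcomp Require Import generic_quotient.
From mathcomp Require Import all_classical all_reals all_analysis.

Set Implicit Arguments.
Unset Strict Implicit.
Unset Printing Implicit Defensive.

Import Order.TTheory GRing.Theory Num.Theory.
Import numFieldNormedType.Exports.
Local Open Scope classical_set_scope.
Local Open Scope ring_scope.
Local Open Scope quotient_scope.

(** * Metric geometry

   Distances are functions [rho : Y -> Y -> R]; [is_metric rho] says that
   [rho] is a metric.  The other notions make sense for any [rho] and have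
   their usual meaning when [rho] is a metric. *)

Definition is_metric (R : realType) (Y : Type) (rho : Y -> Y -> R) : Prop :=
  [/\ forall x y, 0 <= rho x y,
      forall x y, rho x y = 0 <-> x = y,
      forall x y, rho x y = rho y x &
      forall x y z, rho x z <= rho x y + rho y z].

Definition mball (R : realType) (Y : Type) (rho : Y -> Y -> R) (p : Y) (r : R) :
  set Y := [set q | rho p q < r].

Definition sub_dist (R : realType) (Y : Type) (rho : Y -> Y -> R) (A : set Y) :
  A -> A -> R := fun x y => rho (set_val x) (set_val y).
Arguments sub_dist {R Y} rho A.

(* Unit speed geodesics; only the values of [c] on [0, rho x y] matter. *)
Definition geodesic (R : realType) (Y : Type) (rho : Y -> Y -> R) (x y : Y)
    (c : R -> Y) : Prop :=
  [/\ c 0 = x, c (rho x y) = y &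
      forall s t, s \in `[0, rho x y] -> t \in `[0, rho x y] ->
        rho (c s) (c t) = `|s - t|].

(* The simply connected surface of constant curvature [kappa], inside R^3:
   a sphere rescaled from radius 1, the plane z = 0, or a hyperboloid sheet
   rescaled from curvature -1. *)
Definition in_model (R : realType) (kappa : R) (p : R * R * R) : Prop :=
  let: (x, y, z) := p in
  if 0 < kappa then x ^+ 2 + y ^+ 2 + z ^+ 2 = 1
  else if kappa == 0 then z = 0
  else z ^+ 2 - x ^+ 2 - y ^+ 2 = 1 /\ 0 < z.

Definition acosh (R : realType) (x : R) : R :=
  ln (x + Num.sqrt (x ^+ 2 - 1)).

Definition model_dist (R : realType) (kappa : R) (p q : R * R * R) : R :=
  let: (x, y, z) := p in
  let: (x', y', z') := q in
  if 0 < kappa then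
    acos (x * x' + y * y' + z * z') / Num.sqrt kappa
  else if kappa == 0 then
    Num.sqrt ((x - x') ^+ 2 + (y - y') ^+ 2 + (z - z') ^+ 2)
  else
    acosh (z * z' - x * x' - y * y') / Num.sqrt (- kappa).

(* For [kappa <= 0] there is no restriction on distances. *)
Definition below_diameter (R : realType) (kappa : R) (l : R) : Prop :=
  0 < kappa -> l < pi / Num.sqrt kappa.

(* [p'], [q'], [r'] are the vertices of a comparison triangle; [x'] and [y']
   are the comparison points of the points [x = c1 s] and [y = c2 t] lying on
   two sides.  Up to relabelling the vertices and reversing the sides, every
   pair of sides is the pair [p,q], [p,r]. *)
Definition thin_triangles (R : realType) (kappa : R) (Y : Type)
    (rho : Y -> Y -> R) : Prop :=
  forall (p q r : Y) (c1 c2 c3 : R -> Y),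
    geodesic rho p q c1 -> geodesic rho p r c2 -> geodesic rho q r c3 ->
    below_diameter kappa ((rho p q + rho p r + rho q r) / 2) ->
  forall p' q' r' : R * R * R,
    in_model kappa p' -> in_model kappa q' -> in_model kappa r' ->
    model_dist kappa p' q' = rho p q ->
    model_dist kappa p' r' = rho p r ->
    model_dist kappa q' r' = rho q r ->
  forall s t : R, s \in `[0, rho p q] -> t \in `[0, rho p r] ->
  forall x' y' : R * R * R,
    in_model kappa x' -> in_model kappa y' ->
    model_dist kappa p' x' = s -> model_dist kappa x' q' = rho p q - s ->
    model_dist kappa p' y' = t -> model_dist kappa y' r' = rho p r - t ->
    rho (c1 s) (c2 t) <= model_dist kappa x' y'.

Definition CAT (R : realType) (kappa : R) (Y : Type) (rho : Y -> Y -> R) :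
    Prop :=
  (forall x y, below_diameter kappa (rho x y) ->
     exists c, geodesic rho x y c) /\
  thin_triangles kappa rho.

Definition nonpositively_curved_at (R : realType) (Y : Type)
    (rho : Y -> Y -> R) (p : Y) : Prop :=
  exists r : R, 0 < r /\ CAT 0 (sub_dist rho (mball rho p r)).

Definition unbounded_curvature_at (R : realType) (Y : Type)
    (rho : Y -> Y -> R) (p : Y) : Prop :=
  ~ exists kappa r : R, 0 < r /\ CAT kappa (sub_dist rho (mball rho p r)).

Definition generically_nonpositively_curved (R : realType) (Y : Type)
    (rho : Y -> Y -> R) : Prop :=
  exists U : set Y,
    [/\ forall p, U p -> exists r : R, 0 < r /\ mball rho p r `<=` U,
        forall p (r : R), 0 < r -> exists q, mball rho p r q /\ U q &
        forall p, U p -> nonpositively_curved_at rho p].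

(* A dataset is a nonempty finite set, given as an injective family.
   Uniqueness below always means "at most one", so that failure of uniqueness
   means that there are two different solutions, not that there is none. *)

Definition geodesics_locally_unique_at (R : realType) (Y : Type)
    (rho : Y -> Y -> R) (p : Y) : Prop :=
  exists r : R, 0 < r /\
    forall x y, mball rho p r x -> mball rho p r y ->
    forall c1 c2, geodesic rho x y c1 -> geodesic rho x y c2 ->
    forall t, t \in `[0, rho x y] -> c1 t = c2 t.

Definition is_mean (R : realType) (Y : Type) (rho : Y -> Y -> R) (m : nat)
    (a : 'I_m -> Y) (x : Y) : Prop :=
  forall y, \sum_i rho x (a i) ^+ 2 <= \sum_i rho y (a i) ^+ 2.

Definition is_circumcenter (R : realType) (Y : Type) (rho : Y -> Y -> R)
    (S : set Y) (x : Y) : Prop :=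
  exists r : R, (forall a, S a -> rho x a <= r) /\
    forall y (r' : R), (forall a, S a -> rho y a <= r') -> r <= r'.

(* Centroids of a family of m + 2 points.  As geodesics need not be unique,
   this is a relation: [b k] is a possible value of c^k, its element [b k.+1 i]
   being a centroid of the family [b k] with the [i]-th member left out. *)
Fixpoint is_centroid (R : realType) (Y : Type) (rho : Y -> Y -> R) (m : nat) :
    ('I_m.+2 -> Y) -> Y -> Prop :=
  match m with
  | 0 => fun a x => exists c : R -> Y,
      geodesic rho (a ord0) (a ord_max) c /\
      x = c (rho (a ord0) (a ord_max) / 2)
  | m'.+1 => fun a x => exists b : nat -> 'I_m'.+3 -> Y,
      [/\ b 0%N = a,
          forall k i, is_centroid rho (fun j => b k (@lift m'.+3 i j)) (b k.+1 i) &
          forall i, (fun k => rho (b k i) x) @ \oo --> (0 : R)]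
  end.

Definition means_locally_unique_at (R : realType) (Y : Type)
    (rho : Y -> Y -> R) (p : Y) : Prop :=
  exists r : R, 0 < r /\
    forall (m : nat) (a : 'I_m.+1 -> Y), injective a ->
    (forall i, mball rho p r (a i)) ->
    forall x y, is_mean rho a x -> is_mean rho a y -> x = y.

Definition centroids_locally_unique_at (R : realType) (Y : Type)
    (rho : Y -> Y -> R) (p : Y) : Prop :=
  exists r : R, 0 < r /\
    forall (m : nat) (a : 'I_m.+2 -> Y), injective a ->
    (forall i, mball rho p r (a i)) ->
    forall x y, is_centroid rho a x -> is_centroid rho a y -> x = y.

Definition circumcenters_locally_unique_at (R : realType) (Y : Type)
    (rho : Y -> Y -> R) (p : Y) : Prop :=
  exists r : R, 0 < r /\
    forall (m : nat) (a : 'I_m.+1 -> Y), injective a ->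
    (forall i, mball rho p r (a i)) ->
    forall x y, is_circumcenter rho (range a) x ->
      is_circumcenter rho (range a) y -> x = y.

Definition curvature_unbounded_everywhere (R : realType) (Y : Type)
    (rho : Y -> Y -> R) : Prop :=
  forall p, unbounded_curvature_at rho p.

Definition geodesics_nowhere_locally_unique (R : realType) (Y : Type)
    (rho : Y -> Y -> R) : Prop :=
  forall p, ~ geodesics_locally_unique_at rho p.

Definition means_nowhere_locally_unique (R : realType) (Y : Type)
    (rho : Y -> Y -> R) : Prop :=
  forall p, ~ means_locally_unique_at rho p.

Definition centroids_nowhere_locally_unique (R : realType) (Y : Type)
    (rho : Y -> Y -> R) : Prop :=
  forall p, ~ centroids_locally_unique_at rho p.

Definition circumcenters_nowhere_locally_unique (R : realType) (Y : Type)
    (rho : Y -> Y -> R) : Prop :=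
  forall p, ~ circumcenters_locally_unique_at rho p.

(** * Length metrics *)

Definition path_continuous (R : realType) (Y : Type) (rho : Y -> Y -> R)
    (c : R -> Y) : Prop :=
  forall s, s \in `[0, 1] -> forall e : R, 0 < e ->
  exists delta : R, 0 < delta /\
    forall t, t \in `[0, 1] -> `|s - t| < delta -> rho (c s) (c t) < e.

(* The metric analogue of [total_variation]. *)
Definition path_length (R : realType) (Y : Type) (rho : Y -> Y -> R)
    (c : R -> Y) : \bar R :=
  ereal_sup [set l : \bar R | exists s : seq R, itv_partition 0 1 s /\
    l = (\sum_(0 <= i < size s)
           rho (c (nth 1 (0 :: s) i)) (c (nth 1 (0 :: s) i.+1)))%:E].

(* Only used on spaces in which any two points are joined by a path of finite
   length, so that [fine] is applied to a real number. *)
Definition length_dist (R : realType) (Y : Type) (rho : Y -> Y -> R)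
    (x y : Y) : R :=
  fine (ereal_inf [set l : \bar R | exists c : R -> Y,
    [/\ path_continuous rho c, c 0 = x, c 1 = y & l = path_length rho c]]).

(** * Quotients *)

Definition kernel_rel (T U : Type) (f : T -> U) : rel T :=
  fun x y => `[< f x = f y >].

Lemma kernel_rel_refl (T U : Type) (f : T -> U) : reflexive (kernel_rel f).
Proof. by move=> x; apply/asboolP. Qed.

Lemma kernel_rel_sym (T U : Type) (f : T -> U) : symmetric (kernel_rel f).
Proof. by move=> x y; apply/asboolP/asboolP => ->. Qed.

Lemma kernel_rel_trans (T U : Type) (f : T -> U) : transitive (kernel_rel f).
Proof. by move=> y x z /asboolP fxy /asboolP fyz; apply/asboolP; rewrite fxy. Qed.

Definition kernel_equiv (T U : Type) (f : T -> U) : equiv_rel T :=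
  EquivRel (kernel_rel f) (kernel_rel_refl f) (kernel_rel_sym f)
    (@kernel_rel_trans T U f).

Definition generated_rel (T : Type) (r : T -> T -> Prop) : rel T :=
  fun x y => `[< clos_refl_sym_trans T r x y >].

Lemma generated_rel_refl (T : Type) (r : T -> T -> Prop) :
  reflexive (generated_rel r).
Proof. by move=> x; apply/asboolP; exact: rst_refl. Qed.

Lemma generated_rel_sym (T : Type) (r : T -> T -> Prop) :
  symmetric (generated_rel r).
Proof. by move=> x y; apply/asboolP/asboolP; exact: rst_sym. Qed.

Lemma generated_rel_trans (T : Type) (r : T -> T -> Prop) :
  transitive (generated_rel r).
Proof.
by move=> y x z /asboolP rxy /asboolP ryz; apply/asboolP; exact: rst_trans ryz.
Qed.

Definition generated_equiv (T : Type) (r : T -> T -> Prop) : equiv_rel T :=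
  EquivRel (generated_rel r) (generated_rel_refl r) (generated_rel_sym r)
    (@generated_rel_trans T r).

Definition quot_dist (R : realType) (T : choiceType) (e : equiv_rel T)
    (rho : T -> T -> R) (a b : {eq_quot e}) : R :=
  inf [set l : R | exists (k : nat) (x y : 'I_k.+1 -> T),
    [/\ \pi_{eq_quot e} (x ord0) = a,
        forall i j : 'I_k.+1, j = i.+1 :> nat -> e (y i) (x j),
        \pi_{eq_quot e} (y ord_max) = b &
        l = \sum_i rho (x i) (y i)]].
Arguments quot_dist {R T} e rho a b.

(** * Trees *)

Inductive bintree := Leaf | Node of bintree & bintree.

(* In [Node l r], the edge from the root to the root of [l] is [inl None], and
   [inl (Some e)] is the edge [e] of [l]; likewise for [r] with [inr]. *)
Fixpoint edge (t : bintree) : finType :=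
  match t with
  | Leaf => void
  | Node l r => (option (edge l) + option (edge r))%type
  end.

(* The next edge on the way to the root, if any. *)
Fixpoint parent (t : bintree) : edge t -> option (edge t) :=
  match t return edge t -> option (edge t) with
  | Leaf => fun _ => None
  | Node l r => fun e =>
    match e with
    | inl None | inr None => None
    | inl (Some e') => Some (inl (parent e'))
    | inr (Some e') => Some (inr (parent e'))
    end
  end.

(* Reorderings, as permutations of the edges.  A rooted tree automorphism is
   determined by its action on edges, since the vertices other than the root
   are the lower endpoints of the edges. *)
Definition reorderings (t : bintree) : {set {perm edge t}} :=
  [set g : {perm edge t} | [forall e, parent (g e) == omap g (parent e)]]%SET.

(* Ordered rooted trees with edge attributes in [A]: the list of the edges
   leaving the root, in order, each with the subtree below it.  Isomorphism of
   such trees is equality in this type. *)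
Inductive otree (A : Type) := ONode of seq (A * otree A).

(* The branch made of an edge with attribute [a] and the trees [s] hanging
   from its lower end; the edge is contracted if [a] is [None]. *)
Definition branch (A : Type) (a : option A) (s : seq (A * otree A)) :
    seq (A * otree A) :=
  if a is Some a' then [:: (a', ONode s)] else s.

Fixpoint collapse_branches (A : Type) (t : bintree) :
    (edge t -> option A) -> seq (A * otree A) :=
  match t return (edge t -> option A) -> seq (A * otree A) with
  | Leaf => fun _ => [::]
  | Node l r => fun f =>
      branch (f (inl None)) (collapse_branches (fun e => f (inl (Some e)))) ++
      branch (f (inr None)) (collapse_branches (fun e => f (inr (Some e))))
  end.

(* Contraction of the edges [e] with [f e = None]; the other edges keep their
   attribute. *)
Definition collapse (A : Type) (t : bintree) (f : edge t -> option A) :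
  otree A := ONode (collapse_branches f).

Definition topology (t : bintree) (E' : {set edge t}) : otree unit :=
  collapse (fun e => if e \in E' then Some tt else None).

(* [reordering s s']: s' arises from s by reordering siblings anywhere. *)
Inductive reordering (A : Type) : otree A -> otree A -> Prop :=
| reordering_nil : reordering (ONode [::]) (ONode [::])
| reordering_cons a u u' s s' :
    reordering u u' -> reordering (ONode s) (ONode s') ->
    reordering (ONode ((a, u) :: s)) (ONode ((a, u') :: s'))
| reordering_swap b b' s :
    reordering (ONode (b :: b' :: s)) (ONode (b' :: b :: s))
| reordering_trans u v w :
    reordering u v -> reordering v w -> reordering u w.

(** * Tree-shape spaces *)

(* (R^d)^n is the space of n x d matrices. *)
Definition preshape (R : realType) (d n : nat) (t : bintree) : choiceType :=
  {ffun edge t -> 'M[R]_(n, d)}.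

Definition enorm (R : realType) (n d : nat) (v : 'M[R]_(n, d)) : R :=
  Num.sqrt (\sum_i \sum_j v i j ^+ 2).

Definition d1 (R : realType) (d n : nat) (t : bintree)
    (x y : preshape R d n t) : R := \sum_e enorm (x e - y e).

Definition d2 (R : realType) (d n : nat) (t : bintree)
    (x y : preshape R d n t) : R := Num.sqrt (\sum_e enorm (x e - y e) ^+ 2).

Definition reorder (R : realType) (d n : nat) (t : bintree) (g : {perm edge t})
    (x : preshape R d n t) : preshape R d n t := [ffun e => x (g^-1%g e)].

Definition collapsed (R : realType) (d n : nat) (t : bintree)
    (x : preshape R d n t) : otree 'M[R]_(n, d) :=
  collapse (fun e => if x e == 0 then None else Some (x e)).

Definition sim (R : realType) (d n : nat) (t : bintree) :
  equiv_rel (preshape R d n t) := kernel_equiv (@collapsed R d n t).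

Definition oshape (R : realType) (d n : nat) (t : bintree) : choiceType :=
  {eq_quot sim R d n t}.

Definition oshape_of (R : realType) (d n : nat) (t : bintree)
  (x : preshape R d n t) : oshape R d n t := \pi_{eq_quot sim R d n t} x.

Definition oshape_dist (R : realType) (d n : nat) (t : bintree)
    (rho : preshape R d n t -> preshape R d n t -> R) :
  oshape R d n t -> oshape R d n t -> R := quot_dist (sim R d n t) rho.

Definition approx (R : realType) (d n : nat) (t : bintree) :
    equiv_rel (oshape R d n t) :=
  generated_equiv (fun a b => exists x g, g \in reorderings t /\
    a = oshape_of x /\ b = oshape_of (reorder g x)).

Definition ushape (R : realType) (d n : nat) (t : bintree) : choiceType :=
  {eq_quot approx R d n t}.

Definition ushape_of (R : realType) (d n : nat) (t : bintree)
  (a : oshape R d n t) : ushape R d n t := \pi_{eq_quot approx R d n t} a.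

(* With [rho := d1] this is the TED metric, with [rho := d2] the QED metric. *)
Definition ushape_dist (R : realType) (d n : nat) (t : bintree)
    (rho : preshape R d n t -> preshape R d n t -> R) :
    ushape R d n t -> ushape R d n t -> R :=
  quot_dist (approx R d n t) (oshape_dist rho).

(** * Restricted tree-shape spaces *)

Definition topology_closed (t : bintree) (F : {set {set edge t}}) : Prop :=
  forall E' E'' : {set edge t},
    E' \in F -> topology E'' = topology E' -> E'' \in F.

Definition saturated (t : bintree) (F : {set {set edge t}}) : Prop :=
  forall E' E'' : {set edge t},
    E' \in F -> reordering (topology E') (topology E'') -> E'' \in F.

Definition rpreshape (R : realType) (d n : nat) (t : bintree)
    (F : {set {set edge t}}) : set (preshape R d n t) :=
  [set x : preshape R d n t | exists E' : {set edge t},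
     E' \in F /\ forall e, e \notin E' -> x e = 0].
Arguments rpreshape R d n {t} F _.

Definition rpreshape_dist (R : realType) (d n : nat) (t : bintree)
    (F : {set {set edge t}})
    (rho : preshape R d n t -> preshape R d n t -> R) :
    rpreshape R d n F -> rpreshape R d n F -> R :=
  length_dist (sub_dist rho (rpreshape R d n F)).

Definition rsim (R : realType) (d n : nat) (t : bintree)
    (F : {set {set edge t}}) : equiv_rel (rpreshape R d n F) :=
  kernel_equiv (fun x : rpreshape R d n F => collapsed (set_val x)).

Definition roshape (R : realType) (d n : nat) (t : bintree)
    (F : {set {set edge t}}) : choiceType := {eq_quot rsim R d n F}.

Definition roshape_dist (R : realType) (d n : nat) (t : bintree)
    (F : {set {set edge t}})
    (rho : preshape R d n t -> preshape R d n t -> R) :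
    roshape R d n F -> roshape R d n F -> R :=
  quot_dist (rsim R d n F) (@rpreshape_dist R d n t F rho).

Definition roshape_incl (R : realType) (d n : nat) (t : bintree)
    (F : {set {set edge t}}) (a : roshape R d n F) : oshape R d n t :=
  oshape_of (set_val (repr a)).

Definition rapprox (R : realType) (d n : nat) (t : bintree)
    (F : {set {set edge t}}) : equiv_rel (roshape R d n F) :=
  kernel_equiv (fun a : roshape R d n F => ushape_of (roshape_incl a)).

Definition rushape (R : realType) (d n : nat) (t : bintree)
    (F : {set {set edge t}}) : choiceType := {eq_quot rapprox R d n F}.

Definition rushape_dist (R : realType) (d n : nat) (t : bintree)
    (F : {set {set edge t}})
    (rho : preshape R d n t -> preshape R d n t -> R) :
    rushape R d n F -> rushape R d n F -> R :=
  quot_dist (rapprox R d n F) (@roshape_dist R d n t F rho).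
Arguments rushape_dist {R d n t} F rho _ _.

(* Main.v *)
(* Any [d1]-Lipschitz function that only depends on the multiset of nonzero edge
   attributes bounds TED from below; the functions [\sum_e max 0 (|x_e| - c)]
   suffice.  Lengthening two edges radially, in either order, gives two
   geodesics with the same endpoints and distinct midpoints, and these exist in
   every ball.  Distinct midpoints are distinct means, centroids and
   circumcenters of the pair of endpoints, and a degenerate triangle with two
   such geodesics as sides contradicts every CAT(kappa) inequality.

   For QED, an equivalence between preshapes carries along every preshape with
   smaller support, at the same distance.  Hence near the class of [x] the
   quotient distance is the distance to the finitely many preshapes in that
   class.  In any ball choose [x] with a maximal number of edges, and perturb it
   so that its attributes are distinct: a small ball around its class is then
   isometric to a Euclidean ball, hence CAT(0). *)

From Stdlib Require Import Relation_Operators.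
Require Import Defs.
From mathcomp Require Import all_boot all_order all_algebra all_fingroup.
From mathcomp Require Import generic_quotient ring lra zify.
From mathcomp Require Import all_classical all_reals all_analysis.

Set Implicit Arguments.
Unset Strict Implicit.
Unset Printing Implicit Defensive.

Import Order.TTheory GRing.Theory Num.Theory.
Import numFieldNormedType.Exports.
Local Open Scope classical_set_scope.
Local Open Scope ring_scope.
Local Open Scope quotient_scope.

(** * Euclidean norms *)

(** A quotient distance is an infimum over chains of any length with arbitrary jumps, so chains are
    never analysed one by one. Upper bounds come from one-leg chains between preshapes supported in
    a common member of the family; lower bounds come only from 1-Lipschitz functions that are
    constant on classes. The record [shape_space] packages these two facts. All later arguments
    start from it, so the full and the restricted spaces, with their two successive quotients and
    the length metric, are treated at once.

    For TED the obstacle is that lengthening one edge or another may give the same class. A head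
    start on an edge that is at least as long as the other breaks this symmetry.

    For QED, maximality of the number of edges excludes neighbours with additional short edges,
    where several flat pieces could meet. Equal attributes could let a reordering fix [x] and
    identify its neighbours; distinct ones leave each nearby class a single representative near
    [x]. *)

Section Euclidean.
Variables (R : realType) (I : finType).
Implicit Types u v w p q : I -> R.

Definition l2 u : R := Num.sqrt (\sum_k u k ^+ 2).

Lemma sumsq_ge0 u : 0 <= \sum_k u k ^+ 2.
Proof. by apply: sumr_ge0 => k _; rewrite sqr_ge0. Qed.

Lemma l2_ge0 u : 0 <= l2 u.
Proof. exact: sqrtr_ge0. Qed.

Lemma sqr_l2 u : l2 u ^+ 2 = \sum_k u k ^+ 2.
Proof. by rewrite sqr_sqrtr ?sumsq_ge0. Qed.

Lemma eq_l2 u v : u =1 v -> l2 u = l2 v.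
Proof. by move=> uv; congr Num.sqrt; apply: eq_bigr => k _; rewrite uv. Qed.

Lemma l2_scale a u : l2 (fun k => a * u k) = `|a| * l2 u.
Proof.
rewrite /l2 -[`|a|]sqrtr_sqr -sqrtrM ?sqr_ge0// mulr_sumr.
by congr Num.sqrt; apply: eq_bigr => k _; rewrite exprMn.
Qed.

Lemma sumsq_comb a b u v : \sum_k (a * u k + b * v k) ^+ 2 =
  a ^+ 2 * (\sum_k u k ^+ 2) + 2 * a * b * (\sum_k u k * v k) +
  b ^+ 2 * (\sum_k v k ^+ 2).
Proof.
rewrite !mulr_sumr -!big_split; apply: eq_bigr => k _ /=; ring.
Qed.

Lemma sumsq_eq0 u : \sum_k u k ^+ 2 = 0 -> forall k, u k = 0.
Proof.
move=> /eqP; rewrite psumr_eq0 => [/allP u0 k|k _]; last exact: sqr_ge0.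
by apply/eqP; have := u0 k (mem_index_enum _); rewrite sqrf_eq0.
Qed.

Lemma l2_eq0 u : l2 u = 0 -> forall k, u k = 0.
Proof. by move=> u0; apply: sumsq_eq0; rewrite -sqr_l2 u0 expr0n. Qed.

(** Cauchy-Schwarz: the squared norm of [l2 v * u - l2 u * v] expands to [2 * (l2 u * l2 v)] times
    the defect of the inequality. *)
Lemma ler_sum_l2 u v : \sum_k u k * v k <= l2 u * l2 v.
Proof.
have [v0|v_neq0] := eqVneq (l2 v) 0.
  rewrite v0 mulr0 big1// => k _; by rewrite (l2_eq0 v0) mulr0.
have v_gt0 : 0 < l2 v by rewrite lt_def v_neq0 l2_ge0.
have [u0|u_neq0] := eqVneq (l2 u) 0.
  by rewrite u0 mul0r big1// => k _; rewrite (l2_eq0 u0) mul0r.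
have u_gt0 : 0 < l2 u by rewrite lt_def u_neq0 l2_ge0.
have := sumsq_ge0 (fun k => l2 v * u k + - l2 u * v k).
rewrite sumsq_comb -!sqr_l2; set c := \sum_k _ => h.
suff : 0 <= 2 * (l2 u * l2 v) * (l2 u * l2 v - c).
  by rewrite pmulr_rge0 ?subr_ge0// !mulr_gt0.
by apply: le_trans h _; rewrite le_eqVlt; apply/orP; left; apply/eqP; ring.
Qed.

Lemma ler_l2D u v : l2 (fun k => u k + v k) <= l2 u + l2 v.
Proof.
rewrite -(@ler_pXn2r _ 2) ?nnegrE ?addr_ge0 ?l2_ge0// sqr_l2.
have -> : \sum_k (u k + v k) ^+ 2 = \sum_k (1 * u k + 1 * v k) ^+ 2.
  by apply: eq_bigr => k _; rewrite !mul1r.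
have := ler_sum_l2 u v; rewrite sumsq_comb -!sqr_l2; nra.
Qed.

Definition l2dist p q := l2 (fun k => p k - q k).

Lemma l2distC p q : l2dist p q = l2dist q p.
Proof.
by congr Num.sqrt; apply: eq_bigr => k _; rewrite -sqrrN opprB.
Qed.

(** The law of cosines at the vertex [r]. *)
Lemma l2dist_sqr p q r : l2dist p q ^+ 2 =
  l2dist r p ^+ 2 + l2dist r q ^+ 2 - 2 * \sum_k (p k - r k) * (q k - r k).
Proof.
rewrite (l2distC r p) (l2distC r q) /l2dist !sqr_l2.
rewrite mulr_sumr -sumrN -!big_split; apply: eq_bigr => k _ /=; ring.
Qed.

(* Equality in the triangle inequality: x lies on the segment [p, q]. *)
Lemma l2dist_between p q x (s : R) :
  l2dist p x = s -> l2dist x q = l2dist p q - s ->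
  forall k, l2dist p q * (x k - p k) = s * (q k - p k).
Proof.
move=> px xq k; apply/eqP; rewrite -subr_eq0; apply/eqP; move: k.
have := l2dist_sqr x q p; rewrite xq px => h.
pose u k := x k - p k; pose v k := q k - p k.
suff : \sum_k (l2dist p q * u k + - s * v k) ^+ 2 = 0.
  by move=> /sumsq_eq0 + k => /(_ k) <-; rewrite mulNr.
rewrite sumsq_comb -!sqr_l2 -/(l2dist x p) -/(l2dist q p).
rewrite (l2distC x p) (l2distC q p) px.
set c := \sum_k _ * _ in h; rewrite -/c; set L := l2dist p q in h *.
(* The law of cosines at [p] forces this value: the case of equality in Cauchy-Schwarz. *)
have -> : c = L * s by lra.
ring.
Qed.

(** The points are fixed proportions of two sides leaving [p], so the law of cosines expresses their
    distance through side lengths alone. The factors [l2dist p q] and [l2dist p r] clear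
    denominators. *)
Lemma l2dist_chord p q r x y (s t : R) :
  l2dist p x = s -> l2dist x q = l2dist p q - s ->
  l2dist p y = t -> l2dist y r = l2dist p r - t ->
  (l2dist p q * l2dist p r) ^+ 2 * l2dist x y ^+ 2 =
  (l2dist p r * s * l2dist p q) ^+ 2 + (l2dist p q * t * l2dist p r) ^+ 2
  - l2dist p r * s * l2dist p q * t *
    (l2dist p q ^+ 2 + l2dist p r ^+ 2 - l2dist q r ^+ 2).
Proof.
move=> px xq py yr.
have hx := l2dist_between px xq; have hy := l2dist_between py yr.
have := l2dist_sqr q r p.
set c := \sum_k _ => hc.
have -> : l2dist p q ^+ 2 + l2dist p r ^+ 2 - l2dist q r ^+ 2 = 2 * c by lra.
move: hc => _; rewrite [in LHS]/l2dist.
rewrite -/(l2dist p q) -/(l2dist p r) sqr_l2 mulr_sumr.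
rewrite (eq_bigr (fun k => (l2dist p r * s * (q k - p k) +
    - (l2dist p q * t) * (r k - p k)) ^+ 2)); last first.
  move=> k _; rewrite -exprMn; congr (_ ^+ 2).
  transitivity (l2dist p r * (l2dist p q * (x k - p k)) -
    l2dist p q * (l2dist p r * (y k - p k))); first by ring.
  by rewrite hy hx; ring.
rewrite sumsq_comb -/c -!sqr_l2 -/(l2dist q p) -/(l2dist r p).
by rewrite (l2distC q) (l2distC r); ring.
Qed.

End Euclidean.

(** The right side of [l2dist_chord] involves only lengths, so it agrees in the two spaces. A side
    of length 0 would make that identity void; then [x] or [y] coincides with the vertex [p]. *)
Lemma l2dist_comparison (R : realType) (I J : finType)
    (p q r x y : I -> R) (p' q' r' x' y' : J -> R) (s t : R) :
  l2dist p' q' = l2dist p q -> l2dist p' r' = l2dist p r ->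
  l2dist q' r' = l2dist q r -> 0 <= s <= l2dist p q -> 0 <= t <= l2dist p r ->
  l2dist p x = s -> l2dist x q = l2dist p q - s ->
  l2dist p y = t -> l2dist y r = l2dist p r - t ->
  l2dist p' x' = s -> l2dist x' q' = l2dist p q - s ->
  l2dist p' y' = t -> l2dist y' r' = l2dist p r - t ->
  l2dist x y = l2dist x' y'.
Proof.
move=> pq pr qr /andP[s0 sL] /andP[t0 tM] px xq py yr px' xq' py' yr'.
have eq0 (K : finType) (u v w : K -> R) :
    l2dist u v = 0 -> l2dist v w = l2dist u w.
  move=> /l2_eq0 uv; apply: eq_l2 => k.
  by congr (_ - _); apply/esym/eqP; rewrite -subr_eq0 uv.
have [L0|L_neq0] := eqVneq (l2dist p q) 0.
  have s00 : s = 0 by lra.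
  by rewrite (eq0 _ p x y) ?px// (eq0 _ p' x' y') ?px'// py py'.
have [M0|M_neq0] := eqVneq (l2dist p r) 0.
  have t00 : t = 0 by lra.
  rewrite (l2distC x) (l2distC x').
  by rewrite (eq0 _ p y x) ?py// (eq0 _ p' y' x') ?py'// px px'.
apply: (@pexpIrn _ 2) => //; rewrite ?nnegrE ?l2_ge0//.
apply: (@mulfI _ ((l2dist p q * l2dist p r) ^+ 2)).
  by rewrite expf_neq0// mulf_neq0.
rewrite (l2dist_chord px xq py yr).
have := @l2dist_chord _ _ p' q' r' x' y' s t.
by rewrite pq pr qr => ->.
Qed.

Section EuclideanNorm.
Variables (R : realType) (n d : nat).
Implicit Types u v w : 'M[R]_(n, d).

Lemma enormE v : enorm v = l2 (fun k : 'I_n * 'I_d => v k.1 k.2).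
Proof. by rewrite /enorm pair_bigA. Qed.

Lemma enorm_ge0 v : 0 <= enorm v.
Proof. exact: sqrtr_ge0. Qed.

Lemma enormZ a v : enorm (a *: v) = `|a| * enorm v.
Proof.
by rewrite !enormE -l2_scale; apply: eq_l2 => k; rewrite mxE.
Qed.

Lemma enorm0 : enorm (0 : 'M[R]_(n, d)) = 0.
Proof. by rewrite -(scale0r 0) enormZ normr0 mul0r. Qed.

Lemma enorm_eq0 v : enorm v = 0 -> v = 0.
Proof.
rewrite enormE => /l2_eq0 v0; apply/matrixP => i j.
by rewrite mxE (v0 (i, j)).
Qed.

Lemma enorm_gt0 v : v != 0 -> 0 < enorm v.
Proof.
move=> v_neq0; rewrite lt_def enorm_ge0 andbT.
by apply: contra v_neq0 => /eqP /enorm_eq0 ->.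
Qed.

Lemma enormN v : enorm (- v) = enorm v.
Proof. by rewrite -scaleN1r enormZ normrN1 mul1r. Qed.

Lemma enormB u v : enorm (u - v) = enorm (v - u).
Proof. by rewrite -opprB enormN. Qed.

Lemma enormD u v : enorm (u + v) <= enorm u + enorm v.
Proof.
rewrite !enormE; apply: (le_trans _ (ler_l2D _ _)); rewrite le_eqVlt.
by apply/orP; left; apply/eqP/eq_l2 => k; rewrite mxE.
Qed.

Lemma enorm_tri u v w : enorm (u - w) <= enorm (u - v) + enorm (v - w).
Proof. by apply: (le_trans _ (enormD _ _)); rewrite addrA subrK. Qed.

Lemma enorm_dist u v : `|enorm u - enorm v| <= enorm (u - v).
Proof.
have := enormD (u - v) v; have := enormD (v - u) u.
rewrite !subrK (enormB v u) => h1 h2.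
by rewrite ler_norml; apply/andP; split; lra.
Qed.

End EuclideanNorm.

(** * Properties shared by [d1] and [d2] *)

Section PreshapeMetrics.
Variables (R : realType) (d n : nat) (t : bintree).
Notation X := (preshape R d n t).
Implicit Types (x y z u v : X) (D : X -> X -> R).

(* The last field says that [D x z] only depends on the multiset of the norms
   [enorm (x e - z e)]. *)
Record edge_metric D : Prop := EdgeMetric {
  edge_metricC : forall x y, D x y = D y x;
  edge_metric_tri : forall x y z, D x z <= D x y + D y z;
  edge_metric_edge : forall x y e, enorm (x e - y e) <= D x y;
  edge_metric_scale : forall a x y u v,
    (forall e, u e - v e = a *: (x e - y e)) -> D u v = `|a| * D x y;
  edge_metric_sums : forall x z x' z',
    (forall psi : R -> R, psi 0 = 0 ->
       \sum_e psi (enorm (x e - z e)) = \sum_e psi (enorm (x' e - z' e))) ->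
    D x z = D x' z' }.

Lemma edge_metric_xx D x : edge_metric D -> D x x = 0.
Proof.
move=> hD; rewrite (edge_metric_scale hD (a := 0) (x := x) (y := x)).
  by rewrite normr0 mul0r.
by move=> e; rewrite subrr scaler0.
Qed.

Lemma edge_metric_ge0 D x y : edge_metric D -> 0 <= D x y.
Proof.
move=> hD; have := edge_metric_tri hD x y x.
by rewrite edge_metric_xx// (edge_metricC hD y); lra.
Qed.

Lemma edge_metric_eq0 D x y : edge_metric D -> D x y = 0 -> x = y.
Proof.
move=> hD xy; apply/ffunP => e; apply/eqP; rewrite -subr_eq0; apply/eqP.
apply/enorm_eq0/le_anti; rewrite enorm_ge0 andbT -xy.
exact: edge_metric_edge.
Qed.

Lemma edge_metric_d1 : edge_metric (@d1 R d n t).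
Proof.
split=> [x y|x y z|x y e|a x y u v h|x z x' z' h]; rewrite /d1.
- by apply: eq_bigr => e _; rewrite enormB.
- by rewrite -big_split; apply: ler_sum => e _; exact: enorm_tri.
- rewrite (bigD1 e)//= lerDl; apply: sumr_ge0 => ? _; exact: enorm_ge0.
- by rewrite mulr_sumr; apply: eq_bigr => e _; rewrite h enormZ.
- exact: (h id).
Qed.

Definition coords (x : X) (k : edge t * ('I_n * 'I_d)) : R :=
  x k.1 k.2.1 k.2.2.

Lemma d2E x y : d2 x y = l2dist (coords x) (coords y).
Proof.
rewrite /d2 /l2dist /l2; congr Num.sqrt.
rewrite -(pair_bigA _ (fun e k => (coords x (e, k) - coords y (e, k)) ^+ 2)) /=.
apply: eq_bigr => e _; rewrite enormE sqr_l2.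
by apply: eq_bigr => k _; rewrite !mxE.
Qed.

Lemma edge_metric_d2 : edge_metric (@d2 R d n t).
Proof.
split=> [x y|x y z|x y e|a x y u v h|x z x' z' h].
- by rewrite !d2E l2distC.
- rewrite !d2E /l2dist; apply: (le_trans _ (ler_l2D _ _)); rewrite le_eqVlt.
  by apply/orP; left; apply/eqP/eq_l2 => k; rewrite addrA subrK.
- rewrite /d2 -[leLHS]ger0_norm ?enorm_ge0// -sqrtr_sqr ler_wsqrtr//.
  by rewrite (bigD1 e)//= lerDl; apply: sumr_ge0 => ? _; rewrite sqr_ge0.
- rewrite !d2E /l2dist -l2_scale; apply: eq_l2 => -[e [i j]] /=.
  by have /matrixP/(_ i j) := h e; rewrite !mxE.
- by rewrite /d2 (h (fun a => a ^+ 2))// expr0n.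
Qed.

Definition comb (a : R) x (b : R) y : X := [ffun e => a *: x e + b *: y e].

Lemma combE a x b y e : comb a x b y e = a *: x e + b *: y e.
Proof. by rewrite ffunE. Qed.

Lemma segment_dist D x y (a b : R) : edge_metric D ->
  D (comb (1 - a) x a y) (comb (1 - b) x b y) = `|a - b| * D x y.
Proof.
move=> hD; rewrite distrC (edge_metric_scale hD (a := b - a) (x := x) (y := y))// => e.
by rewrite !combE; apply/matrixP => i j; rewrite !mxE; ring.
Qed.

Lemma comb10 x y : comb 1 x 0 y = x.
Proof. by apply/ffunP => e; rewrite combE scale1r scale0r addr0. Qed.

Lemma comb01 x y : comb 0 x 1 y = y.
Proof. by apply/ffunP => e; rewrite combE scale1r scale0r add0r. Qed.

(** One coefficient is changed at a time. [comb 0 x 0 y] is the zero preshape, spelled this way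
    because [preshape] is declared as a bare [choiceType]. *)
Lemma comb_dist D x y (a b a' b' : R) : edge_metric D ->
  D (comb a x b y) (comb a' x b' y) <=
  `|a - a'| * D x (comb 0 x 0 y) + `|b - b'| * D y (comb 0 x 0 y).
Proof.
move=> hD; apply: le_trans (edge_metric_tri hD _ (comb a' x b y) _) _.
by apply: lerD; rewrite le_eqVlt; apply/orP; left; apply/eqP;
  apply: edge_metric_scale => // e; rewrite !combE;
  apply/matrixP => i j; rewrite !mxE; ring.
Qed.

Definition supp x : {set edge t} := [set e | x e != 0]%SET.

Lemma suppPn x e : e \notin supp x -> x e = 0.
Proof. by rewrite inE negbK => /eqP. Qed.

Lemma supp_comb x y a b (S : {set edge t}) :
  supp x \subset S -> supp y \subset S -> supp (comb a x b y) \subset S.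
Proof.
move=> /fintype.subsetP xS /fintype.subsetP yS; apply/fintype.subsetP => e; apply: contraLR => eS.
rewrite inE negbK combE (suppPn (contra (xS e) eS)).
by rewrite (suppPn (contra (yS e) eS)) !scaler0 addr0.
Qed.

End PreshapeMetrics.

(** * Contraction of trees and equivalence of preshapes *)

Lemma collapse_Node (A : Type) l r (f : edge (Node l r) -> option A) :
  collapse_branches f =
  branch (f (inl None)) (collapse_branches (fun e => f (inl (Some e)))) ++
  branch (f (inr None)) (collapse_branches (fun e => f (inr (Some e)))).
Proof. by []. Qed.

Section Contraction.
Variables (A B : Type).

(** With values in [option], one operation both relabels edges and contracts them.
    [contract_collapse] shows that it commutes with collapsing, so it depends on the collapsed tree
    only. *)
Fixpoint contract (h : A -> option B) (T : otree A) : seq (B * otree B) :=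
  let: ONode s := T in
  flatten [seq branch (h au.1) (contract h au.2) | au <- s].

Fixpoint attributes (T : otree A) : seq A :=
  let: ONode s := T in
  flatten [seq au.1 :: attributes au.2 | au <- s].

Lemma contract_cat h s s' :
  contract h (ONode (s ++ s')) = contract h (ONode s) ++ contract h (ONode s').
Proof. by rewrite /= map_cat flatten_cat. Qed.

Lemma attributes_cat s s' :
  attributes (ONode (s ++ s')) = attributes (ONode s) ++ attributes (ONode s').
Proof. by rewrite /= map_cat flatten_cat. Qed.

Lemma contract_branch h (a : option A) s :
  contract h (ONode (branch a s)) = branch (obind h a) (contract h (ONode s)).
Proof. by case: a => //= a; rewrite cats0. Qed.

Lemma contract_collapse h t (f : edge t -> option A) :
  contract h (collapse f) = collapse_branches (fun e => obind h (f e)).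
Proof.
rewrite /collapse; elim: t f => [//|l IHl r IHr] f.
by rewrite !collapse_Node contract_cat !contract_branch IHl IHr.
Qed.

End Contraction.

Section Attributes.
Variables (A : Type) (V : nmodType) (psi : A -> V).

(** Turns a sum over the edges of [t] into a function of the collapsed tree, which makes it
    invariant under [sim]. *)
Lemma sum_attributes t (f : edge t -> option A) :
  \sum_e oapp psi 0 (f e) = \sum_(a <- attributes (collapse f)) psi a.
Proof.
have sum_branch (a : option A) s : \sum_(b <- attributes (ONode (branch a s))) psi b =
    oapp psi 0 a + \sum_(b <- attributes (ONode s)) psi b.
  by case: a => [a|] /=; rewrite ?add0r// cats0 big_cons.
have sum_option (T : finType) (F : option T -> V) :
    \sum_e F e = F None + \sum_e F (Some e).
  rewrite (bigD1 None)//=; congr (_ + _).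
  rewrite (reindex_omap Some id) => [|[]//]; apply: eq_bigl => e /=.
  by rewrite eqxx.
rewrite /collapse; elim: t f => [|l IHl r IHr] f.
  by rewrite big_nil big_pred0// => -[].
rewrite collapse_Node attributes_cat big_cat !sum_branch -IHl -IHr.
by rewrite big_sumType /= !sum_option.
Qed.

End Attributes.

(** Each edge of the collapsed tree is one surviving edge of [t], so finer labels placed on the
    collapsed tree can be read back on [t]. The induction cuts the list of branches into the parts
    due to the left and the right subtree. *)
Lemma collapse_lift (A B : Type) (g : B -> A) t (f : edge t -> option A)
    (W : seq (B * otree B)) :
  collapse_branches f = contract (Some \o g) (ONode W) ->
  exists2 w : edge t -> option B, collapse_branches w = W &
    forall e, omap g (w e) = f e.
Proof.
have lift_cat s1 s2 (U : seq (B * otree B)) :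
    s1 ++ s2 = contract (Some \o g) (ONode U) ->
    exists U1 U2, [/\ U = U1 ++ U2, s1 = contract (Some \o g) (ONode U1) &
                     s2 = contract (Some \o g) (ONode U2)].
  elim: U s1 => [|u U IHU] [|a s1].
  - by move=> h; exists [::], [::].
  - by [].
  - by move=> h; exists [::], (u :: U).
  by move=> /= [-> /IHU [U1 [U2 [-> -> ->]]]]; exists (u :: U1), U2.
have lift_branch (a : option A) s (U : seq (B * otree B)) :
    branch a s = contract (Some \o g) (ONode U) ->
    exists b U', [/\ U = branch b U', omap g b = a &
                     s = contract (Some \o g) (ONode U')].
  case: a => [a|]; last by move=> h; exists None, U.
  case: U => [//|[b [U]] [|//]] /= [-> ->].
  by exists (Some b), U.
elim: t f W => [|l IHl r IHr] f W.
  by case: W => // _; exists (fun _ => None) => // -[].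
rewrite collapse_Node => /lift_cat [W1 [W2 [-> ]]].
move=> /lift_branch [b1 [U1 [-> hb1 /IHl [w1 <- hw1]]]].
move=> /lift_branch [b2 [U2 [-> hb2 /IHr [w2 <- hw2]]]].
exists (fun e : edge (Node l r) => match e with
  | inl None => b1 | inl (Some e') => w1 e'
  | inr None => b2 | inr (Some e') => w2 e' end) => //.
by move=> [[e|]|[e|]] /=.
Qed.

Section Transport.
Variables (R : realType) (d n : nat) (t : bintree).
Notation M := 'M[R]_(n, d).
Notation X := (preshape R d n t).
Implicit Types x y z : X.

Definition opt (v : M) : option M := if v == 0 then None else Some v.

Lemma collapsed_inj x y : collapsed x = collapsed y ->
  collapse_branches (opt \o x) = collapse_branches (opt \o y).
Proof. by case. Qed.

Definition same_shape x y : Prop :=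
  ushape_of (oshape_of x) = ushape_of (oshape_of y).

(** Replaces the two nested quotients by one generated equivalence of preshapes. The chosen
    representatives are absorbed by the clause for equal collapsed trees. *)
Lemma same_shape_ind (P : X -> X -> Prop) :
  (forall x, P x x) -> (forall x y, P x y -> P y x) ->
  (forall x y z, P x y -> P y z -> P x z) ->
  (forall x y, collapsed x = collapsed y -> P x y) ->
  (forall x g, g \in reorderings t -> P x (reorder g x)) ->
  forall x y, same_shape x y -> P x y.
Proof.
move=> Pxx PC Ptrans Psim Pg x y /eqmodP /asboolP h.
have Pr z : P (repr (oshape_of z)) z.
  by apply: Psim; have /eqmodP/asboolP := reprK (oshape_of z).
suff : P (repr (oshape_of x)) (repr (oshape_of y)).
  by move=> h'; exact: (Ptrans _ _ _ (PC _ _ (Pr x)) (Ptrans _ _ _ h' (Pr y))).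
elim: h => {x y} [a b [x [g [hg [-> ->]]]]|a|a b _|a b c _ h1 _]; last 3 first.
- exact: Pxx.
- exact: PC.
- exact: Ptrans.
exact: (Ptrans _ _ _ (Pr x) (Ptrans _ _ _ (Pg _ _ hg) (PC _ _ (Pr _)))).
Qed.

Lemma same_shape_sim x y : collapsed x = collapsed y -> same_shape x y.
Proof. by move=> xy; congr ushape_of; apply/eqmodP/asboolP. Qed.

Lemma same_shape_reorder x g :
  g \in reorderings t -> same_shape x (reorder g x).
Proof.
by move=> hg; apply/eqmodP/asboolP/rst_step; exists x, g.
Qed.

Lemma same_shape_refl x : same_shape x x. Proof. by []. Qed.
Lemma same_shape_sym x y : same_shape x y -> same_shape y x.
Proof. by rewrite /same_shape. Qed.
Lemma same_shape_trans y x z :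
  same_shape x y -> same_shape y z -> same_shape x z.
Proof. by rewrite /same_shape => ->. Qed.

Lemma oapp_opt (V : nmodType) (phi : M -> V) v :
  phi 0 = 0 -> oapp phi 0 (opt v) = phi v.
Proof. by rewrite /opt; case: eqP => [->|]. Qed.

(** Both generators preserve the multiset of nonzero attributes. Taking [V := nat] and an indicator
    for [phi] counts the edges, or the edges with a given attribute. *)
Lemma same_shape_sum (V : nmodType) (phi : M -> V) x y : phi 0 = 0 ->
  same_shape x y -> \sum_e phi (x e) = \sum_e phi (y e).
Proof.
move=> phi0; apply: (@same_shape_ind
  (fun x y => \sum_e phi (x e) = \sum_e phi (y e))) => //.
- by move=> ? ? ? -> ->.
- move=> {}x {}y xy.
  have sumE z : \sum_e phi (z e) =
      \sum_(v <- attributes (collapsed z)) phi v.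
    rewrite -(sum_attributes phi (opt \o z)).
    by apply: eq_bigr => e _; rewrite oapp_opt.
  by rewrite !sumE xy.
- move=> {}x g _; rewrite [LHS](reindex_inj (@perm_inj _ g^-1%g)).
  by apply: eq_bigr => e _; rewrite ffunE.
Qed.

Lemma same_shape_card x y : same_shape x y -> #|supp x| = #|supp y|.
Proof.
move=> xy; have := @same_shape_sum nat (fun v => (v != 0) : nat) x y.
rewrite eqxx => /(_ erefl xy) h.
have cardE z : #|supp z| = (\sum_e (z e != 0%R))%N.
  by rewrite -sum1_card big_mkcond; apply: eq_bigr => e _; rewrite inE; case: eqP.
by rewrite !cardE.
Qed.

Lemma same_shape_value x y e :
  same_shape x y -> x e != 0 -> exists e', y e' = x e.
Proof.
move=> xy xe0.
have := @same_shape_sum nat (fun v => (v == x e) : nat) x y.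
rewrite eq_sym (negbTE xe0) => /(_ erefl xy).
rewrite (bigD1 e)//= eqxx => h.
have /existsP[e' /eqP] : [exists e', y e' == x e]; last by exists e'.
apply: contraPT h => /existsPn h; rewrite [RHS]big1// => e' _.
by rewrite (negbTE (h e')).
Qed.

(** [x] is carried along when [z] is replaced by [z']. The sums over all [psi] say that the multiset
    of nonzero edge differences is kept, which by [edge_metric_sums] keeps the distance for [d1] and
    [d2] alike. *)
Definition transport z z' : Prop :=
  forall x, supp x \subset supp z -> exists x',
    [/\ supp x' \subset supp z', same_shape x' x &
        forall psi : R -> R, psi 0 = 0 ->
        \sum_e psi (enorm (x' e - z' e)) = \sum_e psi (enorm (x e - z e))].

Lemma transport_trans z z' z'' :
  transport z z' -> transport z' z'' -> transport z z''.
Proof.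
move=> h h' x /h [x' [/h' [x'' [s'' r'' e'']] r' e']].
exists x''; split=> // [|psi psi0]; first exact: same_shape_trans r'' r'.
by rewrite e''// e'.
Qed.

(** Every edge of the common collapsed tree is labelled by the pair of attributes of [z] and [x];
    [collapse_lift] reads these pairs back through [z'], and their second components form [x']. No
    edge of [x] is lost, since the support of [x] lies in that of [z]. *)
Lemma transport_sim z z' : collapsed z = collapsed z' -> transport z z'.
Proof.
move=> zz' x xz.
pose w e : option (M * M) := if z e == 0 then None else Some (z e, x e).
have : collapse_branches (opt \o z') =
    contract (Some \o fst) (ONode (collapse_branches w)).
  rewrite -/(collapse w) contract_collapse -(collapsed_inj zz').
  by congr collapse_branches; apply/funext => e; rewrite /w /opt /=; case: eqP.
move=> /collapse_lift [w' ww' fw'].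
pose x' : X := [ffun e => oapp snd 0 (w' e)].
have x_opt e : opt (x e) = obind (opt \o snd) (w e).
  rewrite /w; case: eqP => //= ze0.
  have /suppPn -> : e \notin supp x.
    by apply: contra (fintype.subsetP xz e) _; rewrite inE ze0 eqxx.
  by rewrite /opt eqxx.
have x'_opt e : opt (x' e) = obind (opt \o snd) (w' e).
  by rewrite ffunE; case: (w' e) => //=; rewrite /opt eqxx.
have collapse_ww' : collapse w' = collapse w by rewrite /collapse ww'.
exists x'; split.
- apply/fintype.subsetP => e; rewrite !inE ffunE; have := fw' e; rewrite /= /opt.
  by case: (w' e) => [[a b]|] /=; case: eqP => //; rewrite eqxx.
- apply: same_shape_sim; rewrite /collapsed /collapse; congr ONode.
  have -> : (fun e => if x' e == 0 then None else Some (x' e)) =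
      (fun e => obind (opt \o snd) (w' e)) by apply/funext => e; rewrite -x'_opt.
  rewrite -contract_collapse collapse_ww' contract_collapse.
  by congr collapse_branches; apply/funext => e; rewrite -x_opt.
move=> psi psi0.
pose f (ab : M * M) := psi (enorm (ab.2 - ab.1)).
transitivity (\sum_e oapp f 0 (w' e)).
  apply: eq_bigr => e _; rewrite ffunE; have := fw' e; rewrite /= /opt.
  case: (w' e) => [[a b]|] /=; case: eqP => //; first by move=> _ [<-].
  by move=> -> _; rewrite subrr enorm0.
rewrite sum_attributes collapse_ww' -sum_attributes.
apply: eq_bigr => e _; rewrite /w; case: eqP => //= ze0.
have -> : x e = 0.
  apply: suppPn; apply: contra (fintype.subsetP xz e) _.
  by rewrite inE ze0 eqxx.
by rewrite ze0 subrr enorm0.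
Qed.

Lemma reorderings_inv g : g \in reorderings t -> (g^-1)%g \in reorderings t.
Proof.
rewrite !inE => /forallP h; apply/forallP => e; apply/eqP.
apply: (@inj_omap _ _ g); first exact: perm_inj.
have /eqP <- := h (g^-1 e)%g; rewrite permKV.
by rewrite -[LHS]omap_id; case: (parent e) => //= e'; rewrite permKV.
Qed.

Lemma reorderK g x : reorder g (reorder (g^-1)%g x) = x.
Proof. by apply/ffunP => e; rewrite !ffunE invgK permKV. Qed.

Lemma transport_reorder z g : g \in reorderings t -> transport z (reorder g z).
Proof.
move=> hg x xz; exists (reorder g x); split.
- apply/fintype.subsetP => e; have := fintype.subsetP xz (g^-1 e)%g.
  by rewrite !inE !ffunE.
- exact/same_shape_sym/same_shape_reorder.
move=> psi _; rewrite [RHS](reindex_inj (@perm_inj _ g^-1%g)).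
by apply: eq_bigr => e _; rewrite !ffunE.
Qed.

Lemma same_shape_transport z z' : same_shape z z' -> transport z z'.
Proof.
(* [transport] is not visibly symmetric, so the induction carries both directions. *)
move=> zz'; suff : transport z z' /\ transport z' z by case.
move: zz'; apply: (@same_shape_ind
  (fun z z' => transport z z' /\ transport z' z)).
- by move=> {}z; split=> x xz; exists x.
- by move=> x y [].
- move=> x y w [xy yx] [yw wy].
  by split; [exact: transport_trans xy yw|exact: transport_trans wy yx].
- by move=> x y xy; split; apply: transport_sim.
move=> x g hg; split; first exact: transport_reorder.
rewrite -{2}[x](reorderK g^-1%g) invgK.
by apply: transport_reorder; exact: reorderings_inv.
Qed.

End Transport.

(** * Quotient metrics and length metrics *)

Section QuotientMetric.
Variables (R : realType) (T : choiceType) (e : equiv_rel T) (rho : T -> T -> R).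
Hypothesis rho_ge0 : forall x y, 0 <= rho x y.
Notation Q := {eq_quot e}.
Implicit Types (a b c : Q) (x y : T).

Definition chain_lengths a b : set R :=
  [set l | exists (k : nat) (x y : 'I_k.+1 -> T),
    [/\ \pi_Q (x ord0) = a,
        forall i j : 'I_k.+1, j = i.+1 :> nat -> e (y i) (x j),
        \pi_Q (y ord_max) = b &
        l = \sum_i rho (x i) (y i)]].

Lemma quot_distE a b : quot_dist e rho a b = inf (chain_lengths a b).
Proof. by []. Qed.

Lemma chain_lengths_lb a b : lbound (chain_lengths a b) 0.
Proof. by move=> _ [k [x [y [_ _ _ ->]]]]; exact: sumr_ge0. Qed.

Lemma chain_lengths1 x y : chain_lengths (\pi_Q x) (\pi_Q y) (rho x y).
Proof.
exists 0%N, (fun _ => x), (fun _ => y); split=> // [i j|].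
  by rewrite (ord1 j).
by rewrite big_ord1.
Qed.

Lemma chain_lengths_has_inf a b : has_inf (chain_lengths a b).
Proof.
split; last by exists 0; exact: chain_lengths_lb.
by exists (rho (repr a) (repr b)); have := chain_lengths1 (repr a) (repr b); rewrite !reprK.
Qed.

Lemma quot_dist_ge0 a b : 0 <= quot_dist e rho a b.
Proof.
rewrite quot_distE; apply: lb_le_inf (@chain_lengths_lb a b).
exact: (chain_lengths_has_inf a b).1.
Qed.

Lemma quot_dist_pi x y : quot_dist e rho (\pi_Q x) (\pi_Q y) <= rho x y.
Proof.
rewrite quot_distE; apply: ge_inf (chain_lengths1 x y).
exact: (chain_lengths_has_inf _ _).2.
Qed.

Lemma chain_lengths_cat a b c l l' :
  chain_lengths a b l -> chain_lengths b c l' -> chain_lengths a c (l + l').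
Proof.
move=> [k [x [y [<- hxy yb ->]]]] [k' [x' [y' [x'b hxy' <- ->]]]].
pose cat (u : 'I_k.+1 -> T) (u' : 'I_k'.+1 -> T) (i : 'I_(k.+1 + k'.+1)) :=
  match fintype.split i with inl j => u j | inr j => u' j end.
have catl u u' j : cat u u' (lshift _ j) = u j.
  by rewrite /cat (unsplitK (inl j)).
have catr u u' j : cat u u' (rshift _ j) = u' j.
  by rewrite /cat (unsplitK (inr j)).
exists (k + k'.+1)%N, (cat x x'), (cat y y'); split.
- by rewrite -(catl x x'); congr (\pi_Q (cat _ _ _)); apply/val_inj.
- move=> i j ji; rewrite /cat.
  have {}ji : @nat_of_ord (k.+1 + k'.+1) j = (@nat_of_ord (k.+1 + k'.+1) i).+1 := ji.
  case: (@fintype.splitP k.+1 k'.+1 i) => i' hi;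
    case: (@fintype.splitP k.+1 k'.+1 j) => j' hj.
  + by apply: hxy; lia.
  (* The seam: the end of the first chain and the start of the second both represent [b]. *)
  + have -> : i' = ord_max by apply/val_inj => /=; have := ltn_ord i'; lia.
    have -> : j' = ord0 by apply/val_inj => /=; have := ltn_ord i'; lia.
    by apply/eqmodP; rewrite yb x'b.
  + by have := ltn_ord j'; lia.
  + by apply: hxy'; lia.
- by rewrite -(catr y y'); congr (\pi_Q (cat _ _ _)); apply/val_inj => /=; lia.
rewrite [RHS](@big_split_ord _ _ _ k.+1 k'.+1) /=.
by congr (_ + _); apply: eq_bigr => i _; rewrite ?catl ?catr.
Qed.

Lemma quot_dist_tri a b c :
  quot_dist e rho a c <= quot_dist e rho a b + quot_dist e rho b c.
Proof.
apply/ler_addgt0Pr => eps eps_gt0.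
have eps2 : 0 < eps / 2 by rewrite divr_gt0.
have [l hl lab] := inf_adherent eps2 (chain_lengths_has_inf a b).
have [l' hl' lbc] := inf_adherent eps2 (chain_lengths_has_inf b c).
apply: (@le_trans _ _ (l + l')).
  apply: ge_inf (chain_lengths_cat hl hl').
  exact: (chain_lengths_has_inf _ _).2.
rewrite !quot_distE; lra.
Qed.

Lemma quot_distC : (forall x y, rho x y = rho y x) ->
  forall a b, quot_dist e rho a b = quot_dist e rho b a.
Proof.
move=> rhoC.
suff le_ab a b : quot_dist e rho a b <= quot_dist e rho b a.
  by move=> a b; apply/le_anti/andP; split; exact: le_ab.
rewrite [leRHS]quot_distE; apply: lb_le_inf; first exact: (chain_lengths_has_inf _ _).1.
move=> _ [k [x [y [xb hxy ya ->]]]].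
apply: ge_inf; first exact: (chain_lengths_has_inf _ _).2.
exists k, (y \o @rev_ord _), (x \o @rev_ord _); split=> /=.
- by rewrite -ya; congr (\pi_Q (y _)); apply/val_inj => /=; lia.
- move=> i j ji; rewrite (generic_quotient.equiv_sym e); apply: hxy => /=.
  by have := ltn_ord j; lia.
- by rewrite -xb; congr (\pi_Q (x _)); apply/val_inj => /=; lia.
rewrite (reindex_inj rev_ord_inj); apply: eq_bigr => i _ /=; exact: rhoC.
Qed.

(** Along a chain, [f] drops by at most [rho] on each leg and is unchanged by each jump. *)
Lemma quot_dist_lip (f : T -> R) :
  (forall x y, e x y -> f x = f y) -> (forall x y, f x - f y <= rho x y) ->
  forall x y, f x - f y <= quot_dist e rho (\pi_Q x) (\pi_Q y).
Proof.
move=> fe f_lip x0 y0; rewrite quot_distE; apply: lb_le_inf.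
  exact: (chain_lengths_has_inf _ _).1.
move=> _ [k [x [y [/eqmodP/fe <- hxy /eqmodP/fe <- ->]]]].
elim: k x y hxy => [|k IHk] x y hxy.
  by rewrite big_ord1 (_ : ord_max = ord0)//; apply/val_inj.
rewrite big_ord_recr /=.
have := IHk (fun i => x (widen_ord (leqnSn _) i))
            (fun i => y (widen_ord (leqnSn _) i)).
have -> : widen_ord (leqnSn k.+1) ord0 = ord0 by apply/val_inj.
move=> /(_ (fun i j => hxy (widen_ord (leqnSn _) i) (widen_ord (leqnSn _) j))).
have /fe -> : e (y (widen_ord (leqnSn k.+1) ord_max)) (x ord_max) by apply: hxy.
have := f_lip (x ord_max) (y ord_max).
lra.
Qed.

End QuotientMetric.
Section LengthMetric.
Variables (R : realType) (Y : Type) (rho : Y -> Y -> R).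
Implicit Types (c : R -> Y) (s : seq R) (x y : Y).

Definition polygon c s : R := \sum_(0 <= i < size s)
  rho (c (nth 1 (0 :: s) i)) (c (nth 1 (0 :: s) i.+1)).

Lemma le_path_length c : ((rho (c 0) (c 1))%:E <= path_length rho c)%E.
Proof.
apply: ereal_sup_ubound; exists [:: 1]; split; first exact: itv_partition1.
by rewrite /= big_nat1.
Qed.

Lemma path_length_lipschitz c (K : R) :
  (forall a b, a <= b -> rho (c a) (c b) <= K * (b - a)) ->
  (path_length rho c <= K%:E)%E.
Proof.
move=> cK; apply: ge_ereal_sup => _ [s [hs ->]]; rewrite lee_fin.
apply: (@le_trans _ _ (\sum_(0 <= i < size s)
    K * (nth 1 (0 :: s) i.+1 - nth 1 (0 :: s) i))).
  rewrite !big_nat; apply: ler_sum => i /= ilt.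
  by apply: cK; have [/(pathP 1)/(_ i ilt)/ltW] := hs.
rewrite -mulr_sumr (telescope_sumr (fun i => nth 1 (0 :: s) i))//=.
by rewrite (itv_partition_nth_size 1 hs) subr0 mulr1.
Qed.

Hypothesis rhoC : forall x y, rho x y = rho y x.

Lemma polygon_rev c s : itv_partition 0 1 s ->
  exists2 s', itv_partition 0 1 s' & polygon (fun a => c (1 - a)) s = polygon c s'.
Proof.
move=> hs; pose m := [seq 1 - a | a <- s].
have last_m : last 1 m = 0.
  have := last_map (fun a : R => 1 - a) s 0; rewrite subr0 => ->.
  by case: hs => _ /eqP ->; rewrite subrr.
(* A partition omits its left end 0 and contains its right end 1; after reflection the final 0 is
   therefore dropped and 1 is put in. *)
pose s' := rev (belast 1 m).
have s'E : 0 :: s' = rev [seq 1 - a | a <- 0 :: s].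
  by rewrite /= subr0 -/m [1 :: m]lastI rev_rcons last_m.
have size_s' : size s' = size s by rewrite size_rev size_belast size_map.
have nth_s' i : (i <= size s)%N ->
    nth 1 (0 :: s') i = 1 - nth 1 (0 :: s) (size s - i).
  by move=> ile; rewrite s'E nth_rev size_map ?ltnS// subSS (nth_map 1)// ltnS leq_subr.
exists s'.
  case: (hs) => hp /eqP hl; split.
    rewrite /s' -last_m rev_path /m.
    have := @path_map _ _ (fun a : R => 1 - a) (fun a b : R => b < a) 0 s.
    rewrite subr0 => ->; apply: sub_path hp => a b /=; lra.
  rewrite -[last 0 s']/(last 0 (0 :: s')) s'E /= rev_cons last_rcons.
  by rewrite subr0.
rewrite /polygon size_s' [RHS]big_nat_rev !big_nat; apply: eq_bigr => i ilt.
have {}ilt : (i < size s)%N by [].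
rewrite !nth_s'; [|lia..].
rewrite [RHS]rhoC; have -> : (size s - (0 + size s - i.+1).+1 = i)%N by lia.
by have -> : (size s - (0 + size s - i.+1) = i.+1)%N by lia.
Qed.

Lemma path_length_rev c : path_length rho (fun a => c (1 - a)) = path_length rho c.
Proof.
have le_rev b : (path_length rho (fun a => b (1 - a)%R) <= path_length rho b)%E.
  apply: ge_ereal_sup => _ [s [/(polygon_rev b) [s' hs' hp] ->]].
  by apply: ereal_sup_ubound; exists s'; split=> //; congr _%:E.
apply/le_anti/andP; split=> //.
have := le_rev (fun a => c (1 - a)).
by congr (path_length rho _ <= _)%E; apply/funext => a; rewrite subKr.
Qed.

Lemma length_distC x y : length_dist rho x y = length_dist rho y x.
Proof.
congr fine; congr ereal_inf.
suff sub a b : [set l : \bar R | exists c : R -> Y,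
    [/\ path_continuous rho c, c 0 = a, c 1 = b & l = path_length rho c]] `<=`
  [set l : \bar R | exists c : R -> Y,
    [/\ path_continuous rho c, c 0 = b, c 1 = a & l = path_length rho c]].
  by apply/seteqP; split; exact: sub.
move=> _ [c [cc c0 c1 ->]]; exists (fun a => c (1 - a)).
split; rewrite ?subr0 ?subrr ?path_length_rev// => s.
rewrite in_itv /= => /andP[s0 s1] e e_gt0.
have [|delta [delta_gt0 h]] := cc (1 - s) _ e e_gt0.
  by rewrite in_itv /=; apply/andP; split; lra.
exists delta; split=> // u; rewrite in_itv /= => /andP[u0 u1] su; apply: h.
  by rewrite in_itv /=; apply/andP; split; lra.
by rewrite distrC (_ : _ - _ = s - u)//; ring.
Qed.

(** A single Lipschitz path keeps the infimum of lengths finite, so that [fine] does not replace it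
    by a default value. *)
Lemma length_dist_lipschitz c (K : R) :
  (forall a b, a <= b -> rho (c a) (c b) <= K * (b - a)) ->
  rho (c 0) (c 1) <= length_dist rho (c 0) (c 1) <= K.
Proof.
move=> cK.
have inf_le : (ereal_inf [set l : \bar R | exists b : R -> Y,
    [/\ path_continuous rho b, b 0%R = c 0%R, b 1%R = c 1%R & l = path_length rho b]]
    <= K%:E)%E.
  apply: le_trans (path_length_lipschitz cK).
  apply: ereal_inf_lbound; exists c; split=> // s _ e e_gt0.
  exists (e / (`|K| + 1)); split; first by rewrite divr_gt0// ltr_wpDl.
  move=> u _; rewrite ltr_pdivlMr ?ltr_wpDl// => h.
  apply: le_lt_trans h.
  have K_le : K * `|s - u| <= `|s - u| * (`|K| + 1).
    rewrite mulrC; apply: ler_wpM2l => //.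
    by rewrite (le_trans (ler_norm K))// lerDl.
  apply: le_trans K_le; have [su|us] := leP s u.
    by rewrite ler0_norm ?subr_le0// opprB cK.
  by rewrite gtr0_norm ?subr_gt0// rhoC cK// ltW.
have le_inf : ((rho (c 0) (c 1))%:E <= ereal_inf [set l : \bar R |
    exists b : R -> Y,
    [/\ path_continuous rho b, b 0%R = c 0%R, b 1%R = c 1%R & l = path_length rho b]])%E.
  apply: le_ereal_inf_tmp => _ [b [_ <- <- ->]]; exact: le_path_length.
rewrite /length_dist; move: inf_le le_inf; case: ereal_inf => [r|//|//].
by rewrite !lee_fin => -> ->.
Qed.

End LengthMetric.

(** * Shape spaces *)

Section ShapeSpace.
Variables (R : realType) (d n : nat) (t : bintree).
Notation X := (preshape R d n t).
Implicit Types (x : X) (F : {set {set edge t}}) (D : X -> X -> R).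

(* A common description of the spaces [ushape] and [rushape]: the points of [Y]
   are the [same_shape] classes of the preshapes lying in [F], [rep] picks
   representatives, and the metric [rho] is at most [D] on each subspace of
   preshapes supported in a fixed member of [F]. *)
Record shape_space F D (Y : Type) (rho : Y -> Y -> R) (rep : Y -> X) : Prop :=
  ShapeSpace {
  shape_rep : forall y, rpreshape R d n F (rep y);
  shape_onto : forall x, rpreshape R d n F x -> exists y, same_shape x (rep y);
  shape_inj : forall y y', same_shape (rep y) (rep y') -> y = y';
  shapeC : forall y y', rho y y' = rho y' y;
  shape_tri : forall y y' y'', rho y y'' <= rho y y' + rho y' y'';
  shape_lip : forall f : X -> R,
    (forall x x', same_shape x x' -> f x = f x') ->
    (forall x x', f x - f x' <= D x x') ->
    forall y y', f (rep y) - f (rep y') <= rho y y';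
  shape_flat : forall (E' : {set edge t}) x x' y y', E' \in F ->
    supp x \subset E' -> supp x' \subset E' ->
    same_shape x (rep y) -> same_shape x' (rep y') -> rho y y' <= D x x' }.

Lemma rpreshapeP F x : rpreshape R d n F x <->
  exists2 E' : {set edge t}, E' \in F & supp x \subset E'.
Proof.
split=> [[E' [hE' h]]|[E' hE' h]]; exists E' => //.
  by apply/fintype.subsetP => e; rewrite inE; apply: contraR => /h ->.
split=> // e he; apply: suppPn; apply: contra he; exact: (fintype.subsetP h).
Qed.

Definition urep (y : ushape R d n t) : X := repr (repr y).

Lemma same_shape_urep (y : ushape R d n t) : ushape_of (oshape_of (urep y)) = y.
Proof. by rewrite /urep /ushape_of /oshape_of !reprK. Qed.

Lemma oshape_dist_ge0 D a b : edge_metric D -> 0 <= oshape_dist D a b.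
Proof. by move=> hD; apply: quot_dist_ge0 => x y; exact: edge_metric_ge0. Qed.

(** The unrestricted space is the case of the family whose only member is the full edge set. A
    Lipschitz bound passes through the two quotients by two uses of [quot_dist_lip]. *)
Lemma shape_space_ushape D : edge_metric D ->
  shape_space [set [set: edge t]]%SET D (ushape_dist D) urep.
Proof.
move=> hD.
have o_ge0 a b : 0 <= oshape_dist D a b by exact: oshape_dist_ge0.
have D_ge0 x x' : 0 <= D x x' by exact: edge_metric_ge0.
split.
- move=> y; apply/rpreshapeP; exists [set: edge t]%SET; first by rewrite inE.
  exact: finset.subsetT.
- by move=> x _; exists (ushape_of (oshape_of x)); rewrite /same_shape same_shape_urep.
- by move=> y y'; rewrite /same_shape !same_shape_urep.
- by apply: quot_distC => // a b; apply: quot_distC => // x x'; exact: edge_metricC.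
- move=> y y' y''; exact: quot_dist_tri.
- move=> f f_inv f_lip y y'.
  have of_repr (a : oshape R d n t) : oshape_of (repr a) = a by exact: reprK.
  have := @quot_dist_lip R _ (Defs.approx R d n t) (oshape_dist D) o_ge0
    (fun a => f (repr a)) _ _ (repr y) (repr y').
  rewrite !reprK; apply.
    move=> a b ab; apply: f_inv; rewrite /same_shape !of_repr; exact/eqmodP.
  move=> a b; have := @quot_dist_lip R _ (sim R d n t) D D_ge0 f _ f_lip (repr a) (repr b).
  rewrite !reprK; apply=> x x' xx'; apply: f_inv; congr ushape_of; exact/eqmodP.
move=> E' x x' y y' _ _ _ xy x'y'.
rewrite -(same_shape_urep y) -(same_shape_urep y') -xy -x'y'.
apply: le_trans (quot_dist_pi _ _ _ _) _ => //; exact: quot_dist_pi.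
Qed.

Section Restricted.
Variables (F : {set {set edge t}}) (D : X -> X -> R) (hD : edge_metric D).
Notation Z := (rpreshape R d n F).

Definition rrep (y : rushape R d n F) : X := set_val (repr (repr y)).

Lemma sub_distC : forall x y : Z, sub_dist D Z x y = sub_dist D Z y x.
Proof. by move=> x y; exact: edge_metricC. Qed.

Lemma rpreshape_dist_segment (E' : {set edge t}) (x x' : Z) : E' \in F ->
  supp (set_val x) \subset E' -> supp (set_val x') \subset E' ->
  rpreshape_dist D x x' <= D (set_val x) (set_val x').
Proof.
move=> hE' xE' x'E'.
have inZ a : comb (1 - a) (set_val x) a (set_val x') \in Z.
  by rewrite inE; apply/rpreshapeP; exists E' => //; exact: supp_comb.
pose c a : Z := exist (fun x => x \in Z) _ (inZ a).
have c0 : c 0 = x by apply/val_inj; rewrite /= subr0 comb10.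
have c1 : c 1 = x' by apply/val_inj; rewrite /= subrr comb01.
have c_lip a b : a <= b ->
    sub_dist D Z (c a) (c b) <= D (set_val x) (set_val x') * (b - a).
  move=> ab; rewrite /sub_dist /= segment_dist//.
  by rewrite mulrC ler0_norm ?subr_le0// opprB.
by have /andP[_] := length_dist_lipschitz sub_distC c_lip; rewrite c0 c1.
Qed.

(** Two points of [Z] may lie in different coordinate subspaces, and the straight segment between
    them may leave [Z]. The broken line through the zero preshape [O] stays in [Z]: [p] falls from 1
    to 0 on the first half, [q] rises from 0 to 1 on the second. Its length only serves to make the
    infimum finite. *)
Lemma rpreshape_dist_ge (x x' : Z) :
  D (set_val x) (set_val x') <= rpreshape_dist D x x'.
Proof.
pose p a : R := Num.max 0 (1 - 2 * a); pose q a : R := Num.max 0 (2 * a - 1).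
pose O : X := comb 0 (set_val x) 0 (set_val x').
have inZ a : comb (p a) (set_val x) (q a) (set_val x') \in Z.
  have /rpreshapeP[E1 hE1 xE1] : Z (set_val x) by exact: set_valP.
  have /rpreshapeP[E2 hE2 xE2] : Z (set_val x') by exact: set_valP.
  rewrite inE; apply/rpreshapeP; have [a2|a2] := leP (2 * a) 1.
    have -> : q a = 0 by rewrite /q; apply/max_idPl; lra.
    exists E1 => //; apply/fintype.subsetP => e; rewrite inE combE scale0r addr0 => h.
    by apply: (fintype.subsetP xE1); rewrite inE; apply: contraNN h => /eqP ->; rewrite scaler0.
  have -> : p a = 0 by rewrite /p; apply/max_idPl; lra.
  exists E2 => //; apply/fintype.subsetP => e; rewrite inE combE scale0r add0r => h.
  by apply: (fintype.subsetP xE2); rewrite inE; apply: contraNN h => /eqP ->; rewrite scaler0.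
pose c a : Z := exist (fun x => x \in Z) _ (inZ a).
have c0 : c 0 = x.
  have p0 : p 0 = 1 by rewrite /p max_r; lra.
  have q0 : q 0 = 0 by apply/max_idPl; lra.
  by apply/val_inj; rewrite /= p0 q0 comb10.
have c1 : c 1 = x'.
  have p1 : p 1 = 0 by apply/max_idPl; lra.
  have q1 : q 1 = 1 by rewrite /q max_r; lra.
  by apply/val_inj; rewrite /= p1 q1 comb01.
have c_lip a b : a <= b -> sub_dist D Z (c a) (c b) <=
    (2 * D (set_val x) O + 2 * D (set_val x') O) * (b - a).
  move=> ab; rewrite /sub_dist /=.
  apply: le_trans (comb_dist _ _ _ _ _ _ hD) _; rewrite -/O.
  have h1 : `|p a - p b| <= 2 * (b - a).
    rewrite ler_norml /p; apply/andP.
    by case: (leP 0 (1 - 2 * a)) => ?; case: (leP 0 (1 - 2 * b)) => ?; split; lra.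
  have h2 : `|q a - q b| <= 2 * (b - a).
    rewrite ler_norml /q; apply/andP.
    by case: (leP 0 (2 * a - 1)) => ?; case: (leP 0 (2 * b - 1)) => ?; split; lra.
  rewrite mulrDl; apply: lerD; rewrite mulrAC; apply: ler_wpM2r => //; exact: edge_metric_ge0.
by have /andP[+ _] := length_dist_lipschitz sub_distC c_lip; rewrite c0 c1.
Qed.

Lemma ushape_of_incl (z : Z) :
  ushape_of (roshape_incl (\pi_(roshape R d n F) z)) =
  ushape_of (oshape_of (set_val z)).
Proof.
congr ushape_of; apply/eqmodP/asboolP.
by have /eqmodP/asboolP := reprK (\pi_(roshape R d n F) z).
Qed.

Lemma same_shape_rrep (y : rushape R d n F) (z : Z) :
  same_shape (set_val z) (rrep y) ->
  \pi_(rushape R d n F) (\pi_(roshape R d n F) z) = y.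
Proof.
move=> h; rewrite -[RHS]reprK; apply/eqmodP/asboolP.
by rewrite ushape_of_incl h.
Qed.

Lemma shape_space_rushape : shape_space F D (rushape_dist F D) rrep.
Proof.
have z_ge0 (x x' : Z) : 0 <= rpreshape_dist D x x'.
  exact: le_trans (edge_metric_ge0 _ _ hD) (rpreshape_dist_ge _ _).
have o_ge0 a b : 0 <= @roshape_dist R d n t F D a b by exact: quot_dist_ge0.
split.
- by move=> y; exact: set_valP.
- move=> x /mem_set hx; pose z : Z := exist (fun x => x \in Z) x hx.
  exists (\pi_(rushape R d n F) (\pi_(roshape R d n F) z)).
  rewrite /same_shape -[RHS]/(ushape_of (roshape_incl (repr _))).
  rewrite -(ushape_of_incl z).
  have /eqmodP/asboolP -> // :=
    reprK (\pi_(rushape R d n F) (\pi_(roshape R d n F) z)).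
- move=> y y' /(@same_shape_rrep y' (repr (repr y))) <-.
  by rewrite !reprK.
- apply: quot_distC => // a b; apply: quot_distC => // x x'.
  exact: length_distC sub_distC _ _.
- by move=> y y' y''; exact: quot_dist_tri.
- move=> f f_inv f_lip y y'.
  have := @quot_dist_lip R _ (rapprox R d n F) (@roshape_dist R d n t F D) o_ge0
    (fun a => f (set_val (repr a))) _ _ (repr y) (repr y').
  rewrite !reprK; apply.
    by move=> a b /asboolP ab; apply: f_inv.
  move=> a b; have := @quot_dist_lip R _ (rsim R d n F) (@rpreshape_dist R d n t F D)
    z_ge0 (fun z => f (set_val z)) _ _ (repr a) (repr b).
  rewrite !reprK; apply.
    by move=> z z' /asboolP zz'; apply: f_inv; exact: same_shape_sim.
  by move=> z z'; apply: le_trans (f_lip _ _) (rpreshape_dist_ge _ _).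
move=> E' x x' y y' hE' xE' x'E' xy x'y'.
have xZ : x \in Z by rewrite inE; apply/rpreshapeP; exists E'.
have x'Z : x' \in Z by rewrite inE; apply/rpreshapeP; exists E'.
rewrite -(@same_shape_rrep y (exist (fun x => x \in Z) x xZ))// -(@same_shape_rrep y' (exist (fun x => x \in Z) x' x'Z))//.
apply: le_trans (quot_dist_pi _ _ _ _) _ => //.
apply: le_trans (quot_dist_pi _ _ _ _) _ => //.
exact: (@rpreshape_dist_segment E').
Qed.

End Restricted.

End ShapeSpace.

Lemma positive_lower_bound (R : realType) (I : finType) (P : pred I) (f : I -> R) :
  (forall i, P i -> 0 < f i) -> exists r, 0 < r /\ forall i, P i -> r <= f i.
Proof.
move=> f_gt0.
suff [r [r0 h]] : exists r, 0 < r /\ {in enum I, forall i, P i -> r <= f i}.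
  by exists r; split=> // i; apply: h; rewrite mem_enum.
elim: (enum I) => [|i s [r [r0 h]]]; first by exists 1.
exists (if P i then Num.min r (f i) else r); split.
  by case: ifP => // Pi; rewrite lt_min r0 f_gt0.
move=> j; rewrite inE => /predU1P[->{j} Pi|js Pj].
  by rewrite Pi ge_min lexx orbT.
by case: ifP => _; rewrite ?ge_min h.
Qed.

(** * Small distances in the quotient and definiteness *)

Section LocalStructure.
Variables (R : realType) (d n : nat) (t : bintree).
Notation X := (preshape R d n t).
Variables (F : {set {set edge t}}) (D : X -> X -> R) (Y : Type).
Variables (rho : Y -> Y -> R) (rep : Y -> X).
Hypotheses (hD : edge_metric D) (hS : shape_space F D rho rep).
Implicit Types (x w : X) (y z : Y) (eps delta r : R).

Lemma shape_ge0 y z : 0 <= rho y z.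
Proof.
have zero_lip x x' : (0 : R) - 0 <= D x x' by rewrite subr0 edge_metric_ge0.
by have := @shape_lip _ _ _ _ _ _ _ _ _ hS (fun _ => 0) (fun _ _ _ => erefl) zero_lip y z; rewrite subr0.
Qed.

Definition edge_gap eps x : Prop := forall e, x e != 0 -> eps <= enorm (x e).

Lemma edge_gap_exists x : exists eps, 0 < eps /\ edge_gap eps x.
Proof.
have [e|eps [eps_gt0 h]] := @positive_lower_bound R _ (fun e => x e != 0)
  (fun e => enorm (x e)); first exact: enorm_gt0.
by exists eps.
Qed.

Lemma same_shape_edge_gap eps x x' :
  same_shape x x' -> edge_gap eps x' -> edge_gap eps x.
Proof.
by move=> xx' h e xe0; have [e' x'e'] := same_shape_value xx' xe0; rewrite -x'e' h// x'e'.
Qed.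

(** Contracting an edge of [x] costs at least the norm of its attribute. *)
Lemma edge_gap_supp eps x w :
  edge_gap eps x -> D x w < eps -> supp x \subset supp w.
Proof.
move=> x_sep xw; apply/fintype.subsetP => e; rewrite !inE => xe0.
apply: contraTN xw => /eqP we0; rewrite -leNgt.
have := edge_metric_edge hD x w e; rewrite we0 subr0.
by apply: le_trans; exact: x_sep.
Qed.

(* The distance to the class of x, truncated at eps, is constant on classes: a
   preshape closer than eps to x has all the edges of x, so x can be carried
   along when that preshape is replaced by an equivalent one.  Being 1-Lipschitz
   as well, it bounds [rho] from below. *)
Lemma shape_local eps delta x w y z : edge_gap eps x -> delta <= eps ->
  same_shape x (rep y) -> same_shape w (rep z) -> rho y z < delta ->
  exists2 x', same_shape x' x & D x' w < delta.
Proof.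
move=> x_sep de xy wz yz.
have eps_gt0 : 0 < eps by apply: lt_le_trans de; exact: le_lt_trans (shape_ge0 _ _) yz.
pose S u : set R := [set l | l = eps \/ exists2 x', same_shape x' x & l = D x' u].
have S_inf u : has_inf (S u).
  split; first by exists eps; left.
  exists 0 => _ [->|[x' _ ->]]; [exact: ltW|exact: edge_metric_ge0].
have S_le u l : S u l -> inf (S u) <= l by apply: ge_inf; exact: (S_inf u).2.
have f_le u u' : same_shape u u' -> inf (S u') <= inf (S u).
  move=> uu'; apply: lb_le_inf; first exact: (S_inf u).1.
  move=> _ [->|[x' x'x ->]]; first by apply: S_le; left.
  have [le_eps|lt_eps] := leP eps (D x' u).
    by apply: le_trans le_eps; apply: S_le; left.
  have x'u := edge_gap_supp (same_shape_edge_gap x'x x_sep) lt_eps.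
  have [x'' [_ x''x' sums]] := same_shape_transport uu' x'u.
  apply: S_le; right; exists x''; first exact: same_shape_trans x'x.
  by apply/esym/(edge_metric_sums hD).
have f_inv u u' : same_shape u u' -> inf (S u) = inf (S u').
  by move=> uu'; apply/le_anti/andP; split; apply: f_le => //; exact: same_shape_sym.
have f_lip u u' : inf (S u) - inf (S u') <= D u u'.
  rewrite lerBlDr -lerBlDl; apply: lb_le_inf; first exact: (S_inf u').1.
  move=> _ [->|[x' x'x ->]]; rewrite lerBlDl.
    apply: (@le_trans _ _ eps); first by apply: S_le; left.
    by rewrite lerDr edge_metric_ge0.
  apply: le_trans (S_le u (D x' u) _) _; first by right; exists x'.
  by rewrite addrC (edge_metricC hD u); exact: edge_metric_tri.
have f_lt : inf (S w) < delta.
  have := shape_lip hS f_inv f_lip z y; rewrite -(f_inv _ _ wz) -(f_inv _ _ xy).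
  have : inf (S x) <= 0.
    by apply: S_le; right; exists x => //; rewrite edge_metric_xx.
  by rewrite (shapeC hS z); lra.
have [||l [->|[x' x'x ->]] llt] := @inf_adherent _ (S w) (delta - inf (S w)).
- by rewrite subr_gt0.
- exact: S_inf.
- lra.
by exists x' => //; lra.
Qed.

(** At distance 0, members of the class of [x] come arbitrarily close to [w]. Their attributes are 0
    or attributes of [x], hence finitely many values; a member closer to [w] than all the gaps [a]
    and [b] between these values and the attributes of [w] equals [w]. *)
Lemma shape_metric : is_metric rho.
Proof.
have xx y : rho y y = 0.
  apply/le_anti; rewrite shape_ge0 andbT.
  have /rpreshapeP[E' hE' yE'] := shape_rep hS y.
  by rewrite -(edge_metric_xx (rep y) hD); exact: (shape_flat hS hE').
split; [exact: shape_ge0| |exact: shapeC hS|exact: shape_tri hS].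
move=> y z; split=> [yz|->//].
set x := rep y; set w := rep z.
have [eps [eps_gt0 x_sep]] := edge_gap_exists x.
have [e|a [a_gt0 ha]] := @positive_lower_bound R _ (fun e => w e != 0)
  (fun e => enorm (w e)); first exact: enorm_gt0.
have [e|b [b_gt0 hb]] := @positive_lower_bound R _ (fun e => x e.1 != w e.2)
    (fun e => enorm (x e.1 - w e.2)).
  by rewrite -subr_eq0; exact: enorm_gt0.
have delta_gt0 : 0 < Num.min eps (Num.min a b) by rewrite !lt_min eps_gt0 a_gt0.
have [||||x' x'x x'w] := @shape_local eps (Num.min eps (Num.min a b)) x w y z x_sep.
- by rewrite ge_min lexx.
- by [].
- by [].
- by rewrite yz.
suff x'w_eq : x' = w by apply: (shape_inj hS); apply/same_shape_sym; rewrite -/w -x'w_eq.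
apply/ffunP => e; apply/eqP; apply: contraTT x'w => x'we.
rewrite -leNgt; apply: le_trans (edge_metric_edge hD _ _ e).
have [x'e0|x'e_neq0] := eqVneq (x' e) 0.
  rewrite x'e0 add0r enormN; apply: le_trans (ha e _).
    by rewrite !ge_min lexx orbT.
  by rewrite eq_sym -x'e0.
have [e' xe'] := same_shape_value x'x x'e_neq0.
rewrite -xe'; apply: le_trans (hb (e', e) _) => //=.
  by rewrite !ge_min lexx !orbT.
by rewrite xe'.
Qed.

End LocalStructure.

(** * Non-unique geodesics *)

Section ModelGeodesic.
Variables (R : realType) (kappa : R).

(** A great circle, a straight line or a branch of a hyperbola. The factor [Num.sqrt] of [|kappa|]
    cancels the rescaling in [model_dist], so the speed is 1. *)
Definition model_line (u : R) : R * R * R :=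
  let k := Num.sqrt `|kappa| in
  if 0 < kappa then (cos (k * u), sin (k * u), 0)
  else if kappa == 0 then (u, 0, 0)
  else ((expR (k * u) - expR (- (k * u))) / 2, 0,
        (expR (k * u) + expR (- (k * u))) / 2).

Lemma in_model_line u : in_model kappa (model_line u).
Proof.
rewrite /in_model /model_line; case: ifP => _.
  by rewrite cos2Dsin2 expr0n addr0.
case: ifP => // _; rewrite expRN; set E := expR _.
have E_gt0 : 0 < E by exact: expR_gt0.
split; last by rewrite divr_gt0// addr_gt0// invr_gt0.
by field; rewrite gt_eqF.
Qed.

Lemma acosh_cosh (x : R) : 0 <= x -> acosh ((expR x + expR (- x)) / 2) = x.
Proof.
move=> x_ge0; rewrite /acosh.
have -> : ((expR x + expR (- x)) / 2) ^+ 2 - 1 = ((expR x - expR (- x)) / 2) ^+ 2.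
  by rewrite expRN; field; rewrite gt_eqF// expR_gt0.
rewrite sqrtr_sqr ger0_norm; last first.
  by rewrite divr_ge0// subr_ge0 ler_expR; lra.
by rewrite (_ : _ + _ = expR x) ?expRK//; field.
Qed.

Lemma model_line_dist u v : u <= v -> below_diameter kappa (v - u) ->
  model_dist kappa (model_line u) (model_line v) = v - u.
Proof.
move=> uv below; rewrite /model_dist /model_line.
have [k_gt0|k_le0] := ltP 0 kappa.
  have sk_gt0 : 0 < Num.sqrt kappa by rewrite sqrtr_gt0.
  rewrite gtr0_norm//.
  rewrite -/(Num.sqrt kappa) mulr0 addr0; set k := Num.sqrt kappa in sk_gt0 *.
  have -> : cos (k * u) * cos (k * v) + sin (k * u) * sin (k * v) = cos (k * (v - u)).
    by rewrite mulrBr cosB; ring.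
  rewrite cosK; first by rewrite mulrC mulKf// gt_eqF.
  rewrite in_itv /=; apply/andP; split; first by rewrite mulr_ge0 ?subr_ge0// ltW.
  by rewrite mulrC -ler_pdivlMr//; exact/ltW/below.
have [k0|k_neq0] := eqVneq kappa 0.
  rewrite !subrr !expr0n !addr0 sqrtr_sqr distrC ger0_norm// subr_ge0//.
have sk_gt0 : 0 < Num.sqrt (- kappa) by rewrite sqrtr_gt0 oppr_gt0 lt_def eq_sym k_neq0.
rewrite ler0_norm// mul0r subr0; set k := Num.sqrt _ in sk_gt0 *.
set z := _ - _; have -> : z = (expR (k * (v - u)) + expR (- (k * (v - u)))) / 2.
  rewrite /z mulrBr opprB !expRD !expRN; field.
  by rewrite !gt_eqF ?expR_gt0.
rewrite acosh_cosh; first by rewrite mulrC mulKf// gt_eqF.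
by rewrite mulr_ge0 ?subr_ge0// ltW.
Qed.

End ModelGeodesic.

Section Bigons.
Variables (R : realType) (Y : Type) (rho : Y -> Y -> R).
Hypothesis rho_metric : is_metric rho.
Implicit Types (a b p : Y) (c : R -> Y).

(** The curves stay in the ball for every real parameter, so that they are also curves in the ball
    as a subspace. The bound on [rho a b] controls the perimeter when [kappa] is positive. *)
Definition bigon p (r : R) : Prop := exists a b c1 c2,
  [/\ geodesic rho a b c1, geodesic rho a b c2,
      forall u, mball rho p r (c1 u), forall u, mball rho p r (c2 u) &
      rho a b < r /\ c1 (rho a b / 2) <> c2 (rho a b / 2)].

Hypothesis bigons : forall p (r : R), 0 < r -> bigon p r.

Let rho_ge0 a b : 0 <= rho a b. Proof. by case: rho_metric. Qed.
Let rhoC a b : rho a b = rho b a. Proof. by case: rho_metric. Qed.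
Let rho_tri a b p : rho a p <= rho a b + rho b p. Proof. by case: rho_metric. Qed.
Let rho_xx a : rho a a = 0. Proof. by case: rho_metric => _ h _ _; apply/h. Qed.

Lemma half_itv (l : R) : 0 <= l -> l / 2 \in `[0, l].
Proof. by move=> l0; rewrite in_itv /=; apply/andP; split; lra. Qed.

Lemma geodesic_midpoint a b c : geodesic rho a b c ->
  rho (c (rho a b / 2)) a = rho a b / 2 /\ rho (c (rho a b / 2)) b = rho a b / 2.
Proof.
move=> [c0 cL cd]; have ab0 := rho_ge0 a b.
rewrite -{2}c0 -{4}cL !cd ?half_itv// ?in_itv/= ?lexx ?ab0//.
split; first by rewrite subr0 ger0_norm// divr_ge0.
by rewrite ler0_norm ?opprB; lra.
Qed.

Lemma bigon_neq a b c1 c2 : geodesic rho a b c1 -> geodesic rho a b c2 ->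
  c1 (rho a b / 2) <> c2 (rho a b / 2) -> a <> b.
Proof.
move=> [c10 _ _] [c20 _ _] + ab; rewrite ab rho_xx mul0r => h.
by apply: h; rewrite c10 c20.
Qed.

Let pair a b (i : 'I_2) := if i == ord0 then a else b.

Let pair_inj a b : a <> b -> injective (pair a b).
Proof.
move=> ab i j; rewrite /pair.
case: i => [[|[|//]] hi]; case: j => [[|[|//]] hj] //= h; apply/val_inj => //=.
by case: (ab (esym h)).
Qed.

Let pair_ball p r a b i : mball rho p r a -> mball rho p r b -> mball rho p r (pair a b i).
Proof. by rewrite /pair; case: ifP. Qed.

Let geodesic_ends p r a b c : geodesic rho a b c ->
  (forall u, mball rho p r (c u)) -> mball rho p r a /\ mball rho p r b.
Proof. by move=> [<- <- _] h. Qed.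

Lemma bigons_geodesics : geodesics_nowhere_locally_unique rho.
Proof.
move=> p [r [r0 h]]; have [a [b [c1 [c2 [g1 g2 b1 b2 [_ ne]]]]]] := bigons p r0.
have [ar br] := geodesic_ends g1 b1.
by apply: (ne); apply: (h a b ar br) => //; exact: half_itv.
Qed.

Lemma bigons_means : means_nowhere_locally_unique rho.
Proof.
move=> p [r [r0 h]]; have [a [b [c1 [c2 [g1 g2 b1 b2 [_ ne]]]]]] := bigons p r0.
have [ar br] := geodesic_ends g1 b1.
have mean c : geodesic rho a b c -> is_mean rho (pair a b) (c (rho a b / 2)).
  move=> g y; rewrite !big_ord_recl !big_ord0 /pair /= !addr0.
  have [-> ->] := geodesic_midpoint g.
  have := rho_tri a y b; rewrite (rhoC a y).
  move: (rho_ge0 a b); move: (rho a b) (rho y a) (rho y b) => l u v l0 luv.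
  (* [u + v >= l] and [2 (u^2 + v^2) = (u + v)^2 + (u - v)^2] give at least [l^2 / 2], the value at
     a midpoint. *)
  have := sqr_ge0 (u - v); have : 0 <= (u + v - l) * (u + v + l) by apply: mulr_ge0; lra.
  nra.
apply: (ne); apply: (h _ (pair a b)) => [|i||]; [|exact: pair_ball|exact: mean..].
exact: pair_inj (bigon_neq g1 g2 ne).
Qed.

Lemma bigons_centroids : centroids_nowhere_locally_unique rho.
Proof.
move=> p [r [r0 h]]; have [a [b [c1 [c2 [g1 g2 b1 b2 [_ ne]]]]]] := bigons p r0.
have [ar br] := geodesic_ends g1 b1.
apply: (ne); apply: (h 0%N (pair a b)) => [|i||]; [|exact: pair_ball|..].
- exact: pair_inj (bigon_neq g1 g2 ne).
- by exists c1.
- by exists c2.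
Qed.

Lemma bigons_circumcenters : circumcenters_nowhere_locally_unique rho.
Proof.
move=> p [r [r0 h]]; have [a [b [c1 [c2 [g1 g2 b1 b2 [_ ne]]]]]] := bigons p r0.
have [ar br] := geodesic_ends g1 b1.
have center c : geodesic rho a b c ->
    is_circumcenter rho (range (pair a b)) (c (rho a b / 2)).
  move=> g; exists (rho a b / 2); have [ha hb] := geodesic_midpoint g.
  split=> [_ [i _ <-]|y r' hy]; first by rewrite /pair; case: ifP; rewrite ?ha ?hb.
  have := hy a (ex_intro2 _ _ ord0 I erefl).
  have := hy b (ex_intro2 _ _ ord_max I erefl).
  by have := rho_tri a y b; rewrite (rhoC a y); lra.
apply: (ne); apply: (h _ (pair a b)) => [|i||]; [|exact: pair_ball|exact: center..].
exact: pair_inj (bigon_neq g1 g2 ne).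
Qed.

Lemma bigons_curvature : curvature_unbounded_everywhere rho.
Proof.
move=> p [kappa [r [r0 [_ thin]]]].
(* The triangle [a], [b], [b] has half perimeter [rho a b], which has to stay below the diameter of
   the model sphere. *)
pose r' := if 0 < kappa then Num.min r (pi / Num.sqrt kappa) else r.
have r'0 : 0 < r'.
  by rewrite /r'; case: ifP => // k0; rewrite lt_min r0 divr_gt0 ?pi_gt0// sqrtr_gt0.
have r'r : r' <= r by rewrite /r'; case: ifP => // _; rewrite ge_min lexx.
have [a [b [c1 [c2 [g1 g2 b1 b2 [abr ne]]]]]] := bigons p r'0.
set A := mball rho p r in thin.
have sub q : mball rho p r' q -> q \in A.
  by rewrite inE /A /mball /= => h; exact: lt_le_trans h r'r.
have [ar br] := geodesic_ends g1 b1.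
have below l : l <= rho a b -> below_diameter kappa l.
  move=> lab k0; apply: le_lt_trans lab (lt_le_trans abr _).
  by rewrite /r' k0 ge_min lexx orbT.
pose a' : A := exist (fun q => q \in A) a (sub a ar).
pose b' : A := exist (fun q => q \in A) b (sub b br).
pose c1' u : A := exist (fun q => q \in A) (c1 u) (sub _ (b1 u)).
pose c2' u : A := exist (fun q => q \in A) (c2 u) (sub _ (b2 u)).
have ab0 := rho_ge0 a b.
have g1' : geodesic (sub_dist rho A) a' b' c1'.
  by case: g1 => h0 hL hd; split; [apply/val_inj|apply/val_inj|].
have g2' : geodesic (sub_dist rho A) a' b' c2'.
  by case: g2 => h0 hL hd; split; [apply/val_inj|apply/val_inj|].
have g3' : geodesic (sub_dist rho A) b' b' (fun _ => b').
  split=> // s t; rewrite /sub_dist /= rho_xx !in_itv /= => /andP[s0 s1] /andP[t0 t1].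
  by rewrite (_ : s - t = 0) ?normr0//; lra.
have line u v : 0 <= u -> u <= v -> v <= rho a b ->
    model_dist kappa (model_line kappa u) (model_line kappa v) = v - u.
  by move=> u0 uv vL; apply: model_line_dist => //; apply: below; lra.
pose l := model_line kappa.
set L := rho a b in ab0 line ne.
have dbb : sub_dist rho A b' b' = 0 by exact: rho_xx.
have hb : below_diameter kappa
    ((sub_dist rho A a' b' + sub_dist rho A a' b' + sub_dist rho A b' b') / 2).
  by apply: below; rewrite dbb /sub_dist /=; lra.
have l0L : model_dist kappa (l 0) (l L) = L by rewrite line; lra.
have lLL : model_dist kappa (l L) (l L) = sub_dist rho A b' b'.
  by rewrite dbb line; lra.
have l0m : model_dist kappa (l 0) (l (L / 2)) = L / 2 by rewrite line; lra.
have lmL : model_dist kappa (l (L / 2)) (l L) = L - L / 2 by rewrite line; lra.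
have lmm : model_dist kappa (l (L / 2)) (l (L / 2)) = 0 by rewrite line; lra.
have inm u : in_model kappa (l u) by exact: in_model_line.
(* The comparison triangle degenerates to a segment of [model_line], and both midpoints have the
   same comparison point [l (L / 2)]. *)
have := thin a' b' b' _ _ _ g1' g2' g3' hb _ _ _ (inm 0) (inm L) (inm L)
  l0L l0L lLL (L / 2) (L / 2) (half_itv ab0) (half_itv ab0) _ _
  (inm (L / 2)) (inm (L / 2)) l0m lmL l0m lmL.
rewrite lmm => h; apply: (ne); case: rho_metric => _ eq0 _ _.
by apply/eq0/le_anti; rewrite rho_ge0 andbT.
Qed.

End Bigons.

Lemma collapse_none (A : Type) t (f : edge t -> option A) :
  (forall e, f e = None) -> collapse_branches f = [::].
Proof.
elim: t f => [//|l IHl r IHr] f h.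
by rewrite collapse_Node !h /= IHl ?IHr// => e; rewrite h.
Qed.

Lemma collapse_single (A : Type) t (f : edge t -> option A) e a :
  f e = Some a -> (forall e', e' != e -> f e' = None) ->
  collapse_branches f = [:: (a, ONode [::])].
Proof.
elim: t f e => [//|l IHl r IHr] f e fe h.
rewrite collapse_Node; case: e fe h => [[e|]|[e|]] fe h.
- rewrite (h (inl None))// (h (inr None))//= (collapse_none (fun e' => h (inr (Some e')) isT))//.
  by rewrite cats0; apply: (IHl _ e) => // e' he'; apply: h.
- rewrite fe (h (inr None))//= !collapse_none// => e'; exact: h.
- rewrite (h (inl None))// (h (inr None))//= (collapse_none (fun e' => h (inl (Some e')) isT))//.
  by apply: (IHr _ e) => // e' he'; apply: h.
rewrite fe (h (inl None))//= !collapse_none// => e'; exact: h.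
Qed.

(** * Radial stretching of attributes *)

Section Stretch.
Variables (R : realType) (n d : nat).
Hypotheses (hd : (0 < d)%N) (hn : (0 < n)%N).
Notation M := 'M[R]_(n, d).
Implicit Types v : M.

(** A zero attribute has no radial direction; any nonzero matrix serves there, so that the norm
    grows at unit rate from a contracted edge too. *)
Definition unit_dir v : M :=
  let w := if v == 0 then const_mx 1 else v in (enorm w)^-1 *: w.

Definition stretch v (a : R) : M := v + a *: unit_dir v.

Lemma const_mx1_neq0 : (const_mx 1 : M) != 0.
Proof.
by apply/eqP => /matrixP/(_ (Ordinal hn) (Ordinal hd))/eqP; rewrite !mxE oner_eq0.
Qed.

Lemma enorm_unit_dir v : enorm (unit_dir v) = 1.
Proof.
rewrite /unit_dir; set w := if _ then _ else _.
have /enorm_gt0 w_gt0 : w != 0.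
  by rewrite /w; case: ifP => [_|/negbT//]; exact: const_mx1_neq0.
by rewrite enormZ gtr0_norm ?invr_gt0// mulVf// gt_eqF.
Qed.

Lemma stretch0 v : stretch v 0 = v.
Proof. by rewrite /stretch scale0r addr0. Qed.

Lemma enorm_stretch v a : 0 <= a -> enorm (stretch v a) = enorm v + a.
Proof.
move=> a0; rewrite /stretch; have [->|v_neq0] := eqVneq v 0.
  by rewrite add0r enorm0 add0r enormZ enorm_unit_dir mulr1 ger0_norm.
rewrite /unit_dir (negbTE v_neq0) scalerA -[X in enorm (X + _)]scale1r -scalerDl.
have v_gt0 := enorm_gt0 v_neq0.
rewrite enormZ ger0_norm; last by rewrite addr_ge0// divr_ge0// enorm_ge0.
by rewrite mulrDl mul1r divfK// gt_eqF.
Qed.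

Lemma stretch_dist v a b : enorm (stretch v a - stretch v b) = `|a - b|.
Proof.
rewrite /stretch opprD addrACA subrr add0r -scalerBl enormZ.
by rewrite enorm_unit_dir mulr1.
Qed.

End Stretch.

(** * Bigons in every ball for TED *)

Section TreeEditDistance.
Variables (R : realType) (d n : nat) (t : bintree).
Notation X := (preshape R d n t).
Notation M := 'M[R]_(n, d).
Variables (F : {set {set edge t}}) (Y : Type) (rho : Y -> Y -> R) (rep : Y -> X).
Hypothesis hS : shape_space F (@d1 R d n t) rho rep.
Hypotheses (hd : (0 < d)%N) (hn : (0 < n)%N).
Implicit Types (x : X) (p : Y).

Definition excess (c : R) x : R := \sum_e Num.max 0 (enorm (x e) - c).

Lemma excess_le (c : R) x x' y y' : 0 <= c ->
  same_shape x (rep y) -> same_shape x' (rep y') ->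
  excess c x - excess c x' <= rho y y'.
Proof.
move=> c0.
have inv u u' : same_shape u u' -> excess c u = excess c u'.
  move=> uu'; apply: (same_shape_sum (phi := fun v => Num.max 0 (enorm v - c))) => //.
  by rewrite enorm0 sub0r; apply/max_idPl; rewrite oppr_le0.
move=> /inv -> /inv ->; apply: (shape_lip hS) => // u u'.
rewrite /excess -sumrB; apply: ler_sum => e _.
have := enorm_dist (u e) (u' e); rewrite ler_norml => /andP[h1 h2].
have := enorm_ge0 (u e - u' e).
by case: (leP 0 (enorm (u e) - c)) => ?; case: (leP 0 (enorm (u' e) - c)) => ?; lra.
Qed.

(** Two edges must be free to grow inside one member of [F]. If the member carrying [rep p] has at
    most one edge, the collapsed tree has at most one edge as well, and its attribute can sit on any
    edge of [t]: it is moved into [E1]. *)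
Lemma spread_representative (E1 : {set edge t}) p :
  E1 \in F -> (1 < #|E1|)%N ->
  exists E' x, [/\ E' \in F, (1 < #|E'|)%N, supp x \subset E' &
                  same_shape x (rep p)].
Proof.
move=> hE1 E1_gt1; have /rpreshapeP [E0 hE0 pE0] := shape_rep hS p.
have [E0_gt1|E0_le1] := ltnP 1 #|E0|; first by exists E0, (rep p).
have [supp0|[e0 he0]] := set_0Vmem (supp (rep p)).
  by exists E1, (rep p); split=> //; rewrite supp0 finset.sub0set.
have [e1 he1] : exists e1, e1 \in E1 by apply/card_gt0P; lia.
pose v := rep p e0; have v_neq0 : v != 0 by move: he0; rewrite inE.
pose x : X := [ffun e => if e == e1 then v else 0].
exists E1, x; split=> //.
  apply/fintype.subsetP => e; rewrite inE ffunE; case: (e =P e1) => [->//|_].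
  by rewrite eqxx.
apply: same_shape_sim; rewrite /collapsed /collapse; congr ONode.
rewrite (@collapse_single _ _ _ e1 v); first last.
- by move=> e /negbTE ne; rewrite ffunE ne eqxx.
- by rewrite ffunE eqxx (negbTE v_neq0).
rewrite (@collapse_single _ _ _ e0 v) ?(negbTE v_neq0)// => e ne.
suff -> : rep p e = 0 by rewrite eqxx.
apply: suppPn; apply: contra ne => he; apply/eqP.
by apply: (card_le1_eqP E0_le1); exact: (fintype.subsetP pE0).
Qed.

Section Bigon.
Variables (E' : {set edge t}) (x : X) (p : Y) (e1 e2 : edge t).
Hypotheses (hE' : E' \in F) (xE' : supp x \subset E') (xp : same_shape x (rep p)).
Hypotheses (he1 : e1 \in E') (he2 : e2 \in E') (e12 : e1 != e2).

Let z (s : R * R) : X := [ffun e => if e == e1 then stretch (x e) s.1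
                      else if e == e2 then stretch (x e) s.2 else x e].

Let sum_z (psi : edge t -> M -> R) s : \sum_e psi e (z s e) =
  psi e1 (stretch (x e1) s.1) + psi e2 (stretch (x e2) s.2) +
  \sum_(e | (e != e1) && (e != e2)) psi e (x e).
Proof.
rewrite (bigD1 e1)//= (bigD1 e2) 1?eq_sym//= !ffunE eqxx.
rewrite eq_sym (negbTE e12) eqxx -addrA; congr (_ + (_ + _)).
by apply: eq_bigr => e /andP[/negbTE ne1 /negbTE ne2]; rewrite ffunE ne1 ne2.
Qed.

Let z_dist s s' : d1 (z s) (z s') = `|s.1 - s'.1| + `|s.2 - s'.2|.
Proof.
rewrite /d1 (sum_z (fun e v => enorm (v - z s' e))) big1 ?addr0 => [|e /andP[ne1 ne2]].
  by rewrite !ffunE !eqxx eq_sym (negbTE e12) !stretch_dist.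
by rewrite ffunE (negbTE ne1) (negbTE ne2) subrr enorm0.
Qed.

Let z_supp s : supp (z s) \subset E'.
Proof.
apply/fintype.subsetP => e; rewrite inE ffunE.
case: (e =P e1) => [->//|_]; case: (e =P e2) => [->//|_] xe.
by apply: (fintype.subsetP xE'); rewrite inE.
Qed.

Let z0 : z (0, 0) = x.
Proof. by apply/ffunP => e; rewrite ffunE /= !stretch0 !if_same. Qed.

Lemma stretch_bigon r : 0 < r -> enorm (x e2) <= enorm (x e1) -> bigon rho p r.
Proof.
(* The curves start at distance [del] from [x], have length [2 * del] and end at distance [3 * del],
   still below [r]. *)
move=> r0 x21; pose del := r / 4.
have [pt hpt] : exists pt : R * R -> Y, forall s, same_shape (z s) (rep (pt s)).
  suff /choice [pt hpt] : forall s, exists y, same_shape (z s) (rep y) by exists pt.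
  by move=> s; apply: (shape_onto hS); apply/rpreshapeP; exists E'.
have pt_le s s' : rho (pt s) (pt s') <= `|s.1 - s'.1| + `|s.2 - s'.2|.
  by rewrite -z_dist; exact: (shape_flat hS hE').
have excess_z c s : excess c (z s) = Num.max 0 (enorm (stretch (x e1) s.1) - c) +
    Num.max 0 (enorm (stretch (x e2) s.2) - c) +
    \sum_(e | (e != e1) && (e != e2)) Num.max 0 (enorm (x e) - c).
  by rewrite /excess (sum_z (fun _ v => Num.max 0 (enorm v - c))).
(* [excess 0] is the sum of the norms, which stretching raises by [s.1 + s.2]. Together with
   [pt_le], this makes every path monotone in both parameters a geodesic. *)
have pt_ge s s' : 0 <= s.1 -> 0 <= s.2 -> 0 <= s'.1 -> 0 <= s'.2 ->
    s.1 + s.2 - (s'.1 + s'.2) <= rho (pt s) (pt s').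
  move=> s10 s20 s'10 s'20.
  have := excess_le (lexx 0) (hpt s) (hpt s'); rewrite !excess_z !subr0.
  rewrite !enorm_stretch// !max_r ?addr_ge0 ?enorm_ge0//.
  by apply: le_trans; lra.
(* Clamping freezes the curves outside [[0, 2 * del]], as [bigon] asks for all parameters. *)
pose clamp (u : R) := Num.max 0 (Num.min u (2 * del)).
pose lo (u : R) := Num.min (clamp u) del; pose hi (u : R) := Num.max 0 (clamp u - del).
(* [lo] grows in the first half and [hi] in the second, so [c1] stretches [e1] before [e2] and [c2]
   does the opposite. The initial [del] on [e1] separates the midpoints even if [x e1] and [x e2]
   have equal norm. *)
pose c1 u := pt (del + lo u, hi u); pose c2 u := pt (del + hi u, lo u).
have del0 : 0 < del by rewrite /del divr_gt0.
have clampP u : 0 <= clamp u <= 2 * del.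
  rewrite /clamp le_max lexx /= ge_max ge_min lexx orbT andbT; lra.
have lohi u : [/\ 0 <= lo u, lo u <= del, 0 <= hi u, hi u <= del &
    lo u + hi u = clamp u].
  rewrite /lo /hi; have /andP[] := clampP u; move: (clamp u) => v v0 v2.
  by case: (leP v del) => ?; case: (leP 0 (v - del)) => ?; split; lra.
have mono u v : u <= v -> lo u <= lo v /\ hi u <= hi v.
  move=> uv; have cuv : clamp u <= clamp v.
    by rewrite /clamp ge_max !le_max lexx /= le_min !ge_min uv lexx !orbT.
  rewrite /lo /hi; move: (clamp u) (clamp v) cuv => a b ab.
  by split; [case: (leP a del) => ?; case: (leP b del) => ?|
    case: (leP 0 (a - del)) => ?; case: (leP 0 (b - del)) => ?]; lra.
have clamp_id u : u \in `[0, 2 * del] -> clamp u = u.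
  by rewrite in_itv /= /clamp => /andP[u0 u1]; rewrite min_l// max_r.
have c_dist u v : u <= v -> u \in `[0, 2 * del] -> v \in `[0, 2 * del] ->
    rho (c1 u) (c1 v) = `|u - v| /\ rho (c2 u) (c2 v) = `|u - v|.
  move=> uv /clamp_id uE /clamp_id vE.
  have [lu0 lu1 hu0 hu1 lhu] := lohi u; have [lv0 lv1 hv0 hv1 lhv] := lohi v.
  have [luv huv] := mono u v uv.
  rewrite (shapeC hS (c1 u)) (shapeC hS (c2 u)) ler0_norm ?opprB ?subr_le0//.
  split; apply/le_anti/andP; split.
  - apply: le_trans (pt_le _ _) _ => /=; rewrite !ger0_norm; lra.
  - have := @pt_ge (del + lo v, hi v) (del + lo u, hi u); rewrite /= -/(c1 u) -/(c1 v).
    by move=> h; apply: le_trans (h _ _ _ _); lra.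
  - apply: le_trans (pt_le _ _) _ => /=; rewrite !ger0_norm; lra.
  have := @pt_ge (del + hi v, lo v) (del + hi u, lo u); rewrite /= -/(c2 u) -/(c2 v).
  by move=> h; apply: le_trans (h _ _ _ _); lra.
have itv0 : 0 \in `[0, 2 * del] by rewrite in_itv /=; lra.
have itvL : 2 * del \in `[0, 2 * del] by rewrite in_itv /=; lra.
have lo0 : lo 0 = 0 by rewrite /lo clamp_id// min_l// ltW.
have hi0 : hi 0 = 0 by rewrite /hi clamp_id// max_l//; lra.
have loL : lo (2 * del) = del by rewrite /lo clamp_id// min_r//; lra.
have hiL : hi (2 * del) = del by rewrite /hi clamp_id// max_r//; lra.
have lom : lo del = del by rewrite /lo clamp_id ?min_l// in_itv /=; lra.
have him : hi del = 0 by rewrite /hi clamp_id ?max_l ?subrr// in_itv /=; lra.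
pose a := c1 0; pose b := c1 (2 * del).
have ab : rho a b = 2 * del.
  by have [||| -> _] := c_dist 0 (2 * del); rewrite ?sub0r ?normrN ?ger0_norm//; lra.
have c_itv u v : u \in `[0, 2 * del] -> v \in `[0, 2 * del] ->
    rho (c1 u) (c1 v) = `|u - v| /\ rho (c2 u) (c2 v) = `|u - v|.
  move=> hu hv; have [uv|vu] := leP u v; first exact: c_dist.
  by rewrite (shapeC hS (c1 u)) (shapeC hS (c2 u)) distrC; apply: c_dist => //; exact: ltW.
have ball u : mball rho p r (c1 u) /\ mball rho p r (c2 u).
  have [lu0 lu1 hu0 hu1 lhu] := lohi u.
  have ball_pt s : 0 <= s.1 -> 0 <= s.2 -> s.1 + s.2 < r -> mball rho p r (pt s).
    move=> s1 s2 sr; apply: le_lt_trans sr.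
    apply: le_trans (shape_flat hS hE' xE' (z_supp s) xp (hpt s)) _.
    by rewrite -z0 z_dist /= !sub0r !normrN !ger0_norm.
  by split; apply: ball_pt => /=; rewrite /del in lu1 hu1 del0 *; lra.
exists a, b, c1, c2; rewrite /geodesic ab; split.
- by split=> // s s' hs hs'; have [] := c_itv _ _ hs hs'.
- split=> [||s s' hs hs']; last by have [] := c_itv _ _ hs hs'.
    by rewrite /c2 /a /c1 lo0 hi0.
  by rewrite /c2 /b /c1 loL hiL.
- by move=> u; have [] := ball u.
- by move=> u; have [] := ball u.
split; first by rewrite /del; lra.
rewrite (_ : 2 * del / 2 = del); last by field.
rewrite /c1 /c2 lom him addr0 => c12.
(* If the midpoints, with parameters [(2 * del, 0)] and [(del, del)], coincided, this zero distance
   would bound their excess over [enorm (x e1) + del]. On [e1] and [e2] that excess is [del] at the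
   first and 0 at the second, because [e2] is not longer than [e1]; the other edges contribute
   equally. *)
have := pt_le (del + del, 0) (del + del, 0); rewrite /= !subrr normr0 addr0.
rewrite {2}c12 leNgt => /negP; apply.
have c_ge0 : 0 <= enorm (x e1) + del by rewrite addr_ge0 ?enorm_ge0// ltW.
apply: lt_le_trans (excess_le c_ge0 (hpt _) (hpt _)).
rewrite !excess_z /= !enorm_stretch//; try lra.
rewrite (max_r (x := 0) (y := enorm (x e1) + (del + del) - _)); last lra.
rewrite (max_l (x := 0) (y := enorm (x e2) + 0 - _)); last lra.
rewrite (max_l (x := 0) (y := enorm (x e1) + del - _)); last lra.
rewrite (max_l (x := 0) (y := enorm (x e2) + del - _)); last lra.
lra.
Qed.

End Bigon.

Lemma tree_edit_bigon (E1 : {set edge t}) p r :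
  E1 \in F -> (1 < #|E1|)%N -> 0 < r -> bigon rho p r.
Proof.
move=> hE1 E1_gt1 r0.
have [E' [x [hE' E'_gt1 xE' xp]]] := spread_representative p hE1 E1_gt1.
have [e1 [e2 [he1 he2 e12]]] := card_gt1P E'_gt1.
have [x21|/ltW x12] := leP (enorm (x e2)) (enorm (x e1)).
  exact: (stretch_bigon hE' xE' xp he1 he2).
by apply: (stretch_bigon hE' xE' xp he2 he1); rewrite 1?eq_sym.
Qed.

End TreeEditDistance.

(** * Flat charts *)

Section Charts.
Variables (R : realType) (d n : nat) (t : bintree) (Y : Type) (rho : Y -> Y -> R).
Notation X := (preshape R d n t).
Hypothesis rho_metric : is_metric rho.
Implicit Types (p q y z : Y) (r : R) (S : {set edge t}) (phi : Y -> X).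

Let rho_ge0 y z : 0 <= rho y z. Proof. by case: rho_metric. Qed.
Let rhoC y z : rho y z = rho z y. Proof. by case: rho_metric. Qed.
Let rho_tri y z q : rho y q <= rho y z + rho z q. Proof. by case: rho_metric. Qed.
Let rho_eq0 y z : rho y z = 0 -> y = z. Proof. by case: rho_metric => _ h _ _ /h. Qed.
Let rho_xx y : rho y y = 0. Proof. by case: rho_metric => _ h _ _; apply/h. Qed.
Let hD := edge_metric_d2 R d n t.

Definition flat_chart p r S phi : Prop :=
  [/\ forall y z, mball rho p r y -> mball rho p r z ->
        rho y z = d2 (phi y) (phi z),
      forall y, mball rho p r y -> supp (phi y) \subset S &
      forall x, supp x \subset S -> d2 (phi p) x < r ->
        exists2 y, mball rho p r y & phi y = x].

Lemma flat_chart_sub p r S phi q : flat_chart p r S phi -> mball rho p r q ->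
  flat_chart q (r - rho p q) S phi.
Proof.
move=> [iso sup onto] qr.
have pr : mball rho p r p by rewrite /mball /= rho_xx; exact: le_lt_trans (rho_ge0 p q) qr.
have sub y : mball rho q (r - rho p q) y -> mball rho p r y.
  by rewrite /mball /= => h; have := rho_tri p q y; lra.
split=> [y z /sub yr /sub zr|y /sub yr|x xS qx]; [exact: iso|exact: sup|].
have [|y yr yx] := onto x xS.
  by have := edge_metric_tri hD (phi p) (phi q) x; rewrite -iso//; lra.
by exists y => //; rewrite /mball /= iso// yx.
Qed.

(** Convexity of balls, with [comb (1 - k) a k p] as intermediate point. It keeps segments of a
    chart in its ball, which is thus geodesic by itself. *)
Lemma segment_in_ball (D : X -> X -> R) (p a b : X) (k r : R) : edge_metric D ->
  0 <= k <= 1 -> D p a < r -> D p b < r -> D p (comb (1 - k) a k b) < r.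
Proof.
move=> D_metric /andP[k0 k1] pa pb.
apply: le_lt_trans (edge_metric_tri D_metric _ (comb (1 - k) a k p) _) _.
have -> : D p (comb (1 - k) a k p) = (1 - k) * D p a.
  rewrite -[X in X * _]ger0_norm; last lra.
  apply: edge_metric_scale => // e; rewrite combE.
  by apply/matrixP => i j; rewrite !mxE; ring.
have -> : D (comb (1 - k) a k p) (comb (1 - k) a k b) = k * D p b.
  rewrite -[X in X * _]ger0_norm//.
  apply: edge_metric_scale => // e; rewrite !combE.
  by apply/matrixP => i j; rewrite !mxE; ring.
have [->|k_neq0] := eqVneq k 0; first by rewrite subr0 mul1r mul0r addr0.
have k_gt0 : 0 < k by rewrite lt_def k_neq0.
nra.
Qed.

Definition triple (p : R * R * R) (i : 'I_3) : R :=
  nth 0 [:: p.1.1; p.1.2; p.2] i.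

Lemma model_dist0 (p q : R * R * R) :
  model_dist 0 p q = l2dist (triple p) (triple q).
Proof.
case: p q => [[x y] z] [[x' y'] z']; rewrite /model_dist ltxx eqxx.
by rewrite /l2dist /l2 !big_ord_recl big_ord0 /triple /= addr0 addrA.
Qed.

Lemma flat_chart_CAT p r S phi :
  flat_chart p r S phi -> CAT 0 (sub_dist rho (mball rho p r)).
Proof.
move=> [iso sup onto]; set A := mball rho p r.
have inA (a : A) : mball rho p r (set_val a) by exact: set_valP.
have isoA (a b : A) : sub_dist rho A a b = d2 (phi (set_val a)) (phi (set_val b)).
  exact: iso.
split=> [a b _|].
  have pr : mball rho p r p.
    by rewrite /mball /= rho_xx; exact: le_lt_trans (rho_ge0 _ _) (inA a).
  set L := sub_dist rho A a b.
  (* For [L = 0] the quotient is 0, which still gives the constant path. *)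
  pose k (u : R) := u / L.
  have L0 : 0 <= L by exact: rho_ge0.
  have kP u : u \in `[0, L] -> 0 <= k u <= 1 /\ k u * L = u.
    rewrite in_itv /= /k => /andP[u0 uL].
    have [L00|L_neq0] := eqVneq L 0.
      by rewrite L00 invr0 mulr0 lexx ler01; split=> //; lra.
    have L_gt0 : 0 < L by rewrite lt_def L_neq0.
    by rewrite divr_ge0//= ler_pdivrMr// mul1r uL divfK.
  pose w u := comb (1 - k u) (phi (set_val a)) (k u) (phi (set_val b)).
  (* Off [[0, L]] any point will do: the prolonged segment might leave the ball. *)
  have [c hc] : exists c : R -> A, forall u, u \in `[0, L] -> phi (set_val (c u)) = w u.
    suff /choice [c hc] : forall u, exists y : A, u \in `[0, L] -> phi (set_val y) = w u.
      by exists c.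
    move=> u; have [uL|_] := boolP (u \in `[0, L]); last by exists a.
    have [k01 _] := kP u uL.
    have [||y yr yw] := onto (w u).
    - by apply: supp_comb; exact: sup.
    - by apply: segment_in_ball => //; rewrite -iso//; exact: inA.
    by exists (exist (fun q => q \in A) y (mem_set yr)).
  have cd u v : u \in `[0, L] -> v \in `[0, L] -> sub_dist rho A (c u) (c v) = `|u - v|.
    move=> hu hv; rewrite isoA !hc// segment_dist// -isoA -/L.
    have [_ ku] := kP u hu; have [_ kv] := kP v hv.
    have -> : u - v = (k u - k v) * L by rewrite mulrBl ku kv.
    by rewrite normrM (ger0_norm L0).
  have phi_inj (y z : A) : phi (set_val y) = phi (set_val z) -> y = z.
    move=> yz; apply/val_inj/rho_eq0.
    by rewrite -[LHS]/(sub_dist rho A y z) isoA yz edge_metric_xx.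
  have itv0 : 0 \in `[0, L] by rewrite in_itv /= lexx.
  have itvL : L \in `[0, L] by rewrite in_itv /= lexx L0.
  exists c; split=> //.
    by apply: phi_inj; rewrite hc// /w /k mul0r subr0 comb10.
  apply: phi_inj; rewrite -/L hc// /w /k; have [L00|L_neq0] := eqVneq L 0.
    rewrite L00 mul0r subr0 comb10; apply: (edge_metric_eq0 hD).
    by rewrite -isoA.
  by rewrite divff// subrr comb01.
move=> a b e c1 c2 c3 [c10 c1L c1d] [c20 c2L c2d] _ _ p' q' r' _ _ _.
move=> pq pr qr s u hs hu x' y' _ _ px xq py yr.
move: pq pr qr px xq py yr; rewrite !model_dist0 => pq pr qr px xq py yr.
have isoE (y z : A) : sub_dist rho A y z =
    l2dist (coords (phi (set_val y))) (coords (phi (set_val z))).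
  by rewrite isoA d2E.
have ab0 : 0 <= sub_dist rho A a b by exact: rho_ge0.
have ae0 : 0 <= sub_dist rho A a e by exact: rho_ge0.
have itv0 (l : R) : 0 <= l -> 0 \in `[0, l] by rewrite in_itv /= lexx.
have itvL (l : R) : 0 <= l -> l \in `[0, l] by rewrite in_itv /= lexx andbT.
have c1s : sub_dist rho A a (c1 s) = s /\
    sub_dist rho A (c1 s) b = sub_dist rho A a b - s.
  move: (hs); rewrite in_itv /= => /andP[s0 sL].
  have := c1d _ _ hs (itvL _ ab0); rewrite c1L distrC => ->.
  have := c1d _ _ (itv0 _ ab0) hs; rewrite c10 => ->.
  by rewrite sub0r normrN !ger0_norm// subr_ge0.
have c2u : sub_dist rho A a (c2 u) = u /\
    sub_dist rho A (c2 u) e = sub_dist rho A a e - u.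
  move: (hu); rewrite in_itv /= => /andP[s0 sL].
  have := c2d _ _ hu (itvL _ ae0); rewrite c2L distrC => ->.
  have := c2d _ _ (itv0 _ ae0) hu; rewrite c20 => ->.
  by rewrite sub0r normrN !ger0_norm// subr_ge0.
move: c1s c2u pq pr qr px xq py yr hs hu; rewrite !isoE !in_itv /=.
move=> [c1s c1s'] [c2u c2u'] pq pr qr px xq py yr hs hu.
(* Equality holds: the triangle in the chart is itself Euclidean, although in another dimension than
   its comparison triangle. *)
rewrite le_eqVlt; apply/orP; left; apply/eqP.
by apply: (l2dist_comparison (q' := triple q') (r' := triple r') pq pr qr hs hu).
Qed.

End Charts.

(** The numbers [r / 2], [r / 3], ... are distinct, and one more of them than the size of [s] cannot
    all lie in [s]. *)
Lemma avoid_seq (R : realType) (s : seq R) (r : R) : 0 < r ->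
  exists2 a, 0 < a < r & a \notin s.
Proof.
move=> r0; pose f (i : nat) : R := r / (i + 2)%:R.
have f_inj : injective f.
  move=> i j /(mulfI (lt0r_neq0 r0)) /invr_inj /eqP.
  by rewrite eqr_nat eqn_add2r => /eqP.
have /allPn [a /mapP [i _ ->] ai] : ~~ all (mem s) [seq f i | i <- iota 0 (size s).+1].
  apply/negP => /allP sub.
  have := uniq_leq_size _ sub; rewrite map_inj_uniq// iota_uniq => /(_ isT).
  by rewrite size_map size_iota ltnn.
exists (f i) => //; rewrite /f divr_gt0//= ?ltr0n ?addn_gt0 ?orbT//.
rewrite ltr_pdivrMr ?ltr0n ?addn_gt0 ?orbT// ltr_pMr// ltr1n; lia.
Qed.

Section GenericChart.
Variables (R : realType) (d n : nat) (t : bintree).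
Notation X := (preshape R d n t).
Variables (F : {set {set edge t}}) (Y : Type) (rho : Y -> Y -> R) (rep : Y -> X).
Hypothesis hS : shape_space F (@d2 R d n t) rho rep.
Hypotheses (hd : (0 < d)%N) (hn : (0 < n)%N).
Implicit Types (x w a b : X) (p q y z : Y) (r : R) (S : {set edge t}).

Let hD := edge_metric_d2 R d n t.
Let rho_metric := shape_metric hD hS.
Let rho_ge0 y z : 0 <= rho y z. Proof. by case: rho_metric. Qed.
Let rhoC y z : rho y z = rho z y. Proof. by case: rho_metric. Qed.
Let rho_tri y z q : rho y q <= rho y z + rho z q. Proof. by case: rho_metric. Qed.
Let rho_xx y : rho y y = 0. Proof. by case: rho_metric => _ h _ _; apply/h. Qed.

(** The edges of [x] are moved along constant matrices with distinct nonzero entries [k e]. One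
    matrix entry already detects whether an attribute vanishes or two coincide, and each such
    accident excludes one value of [a]. *)
Lemma perturb x r : 0 < r -> exists x',
  [/\ d2 x x' < r, supp x' = supp x &
      {in supp x &, forall e e', x' e = x' e' -> e = e'}].
Proof.
move=> r0; pose i0 := Ordinal hn; pose j0 := Ordinal hd.
pose k (e : edge t) : R := (enum_rank e).+1%:R.
have k_neq0 e : k e != 0 by rewrite pnatr_eq0.
have k_inj e e' : k e = k e' -> e = e'.
  by move=> /eqP; rewrite eqr_nat eqSS => /eqP /val_inj /enum_rank_inj.
pose v : X := [ffun e => if e \in supp x then const_mx (k e) else 0].
pose o := comb 0 v 0 v.
(* The roots of these linear equations in [a]. Pairs with equal members only add the harmless value
   0 of a division by 0. *)
pose s := [seq - (x e i0 j0) / k e | e <- enum (edge t)] ++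
  [seq - (x u.1 i0 j0 - x u.2 i0 j0) / (k u.1 - k u.2)
     | u <- enum {: edge t * edge t}].
have vo_ge0 : 0 <= d2 v o by exact: edge_metric_ge0.
have [a /andP[a0 ar]] := @avoid_seq R s (r / (d2 v o + 1)) (divr_gt0 r0 (ltr_wpDl vo_ge0 ltr01)).
rewrite mem_cat negb_or => /andP[/mapP as1 /mapP as2].
pose x' := comb 1 x a v.
have x'E e : e \in supp x -> x' e i0 j0 = x e i0 j0 + a * k e.
  by move=> xe; rewrite combE ffunE xe !mxE mul1r.
have x'0 e : e \notin supp x -> x' e = 0.
  by move=> xe; rewrite combE ffunE (negbTE xe) scaler0 addr0 scale1r suppPn.
exists x'; split.
- have -> : d2 x x' = a * d2 v o.
    rewrite (edge_metricC hD) -[X in X * _]gtr0_norm//.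
    apply: (edge_metric_scale hD) => e; rewrite !combE.
    by apply/matrixP => i j; rewrite !mxE; ring.
  move: ar; rewrite ltr_pdivlMr ?ltr_wpDl//; apply: le_lt_trans.
  by rewrite ler_pM2l// lerDl.
- apply/setP => e; have [xe|xe] := boolP (e \in supp x); last first.
    by rewrite inE x'0// eqxx.
  rewrite inE; apply/eqP => /matrixP/(_ i0 j0); rewrite x'E// mxE => h.
  apply: as1; exists e; first by rewrite mem_enum.
  by apply: (canRL (mulfK (k_neq0 e))); lra.
move=> e e' xe xe' /matrixP/(_ i0 j0); rewrite !x'E// => h.
apply: contrapT => ee'; apply: as2; exists (e, e'); first by rewrite mem_enum.
have kk : k e - k e' != 0.
  by apply/eqP => /subr0_eq /k_inj.
by apply: (canRL (mulfK kk)) => /=; lra.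
Qed.

Section Chart.
Variables (p y0 : Y) (r r' : R) (S : {set edge t}) (x : X).
Hypothesis S_max : forall a y, rpreshape R d n F a -> same_shape a (rep y) ->
  rho p y < r -> (#|supp a| <= #|S|)%N.
Hypotheses (Zx : rpreshape R d n F x) (xS : supp x = S) (xy0 : same_shape x (rep y0)).
Hypothesis (r'_gt0 : 0 < r').
Hypothesis y0_sub : forall y, rho y0 y < r' -> rho p y < r.
Hypothesis x_sep : forall e, e \in S -> 4 * r' <= enorm (x e).
Hypothesis x_inj : {in S &, forall e e', enorm (x e - x e') < 4 * r' -> e = e'}.

Let x_gap : edge_gap (4 * r') x.
Proof. by move=> e xe; apply: x_sep; rewrite -xS inE. Qed.

(** Origin of the constant 4: [b] keeps the edges of [x], and has no others by counting. An
    attribute [b e] occurs as some [a e'], whence [x e] and [x e'] differ by less than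
    [3 * r' + r'], and separation gives [e = e']. *)
Lemma chart_unique a b : supp a \subset S -> d2 a x < r' -> d2 b x < 3 * r' ->
  same_shape b a -> b = a.
Proof.
move=> aS ax bx ba; have r'0 := r'_gt0.
have Sb : S \subset supp b.
  rewrite -xS; apply: (edge_gap_supp hD x_gap).
  by rewrite (edge_metricC hD); lra.
have supp_b : S = supp b.
  apply/eqP; rewrite eqEcard Sb (same_shape_card ba); exact: subset_leq_card.
apply/ffunP => e; have [eS|eS] := boolP (e \in S); last first.
  rewrite !suppPn -?supp_b//; apply: contra eS; exact: (fintype.subsetP aS).
have be_neq0 : b e != 0 by move: eS; rewrite supp_b inE.
have [e' ae'] := same_shape_value ba be_neq0.
have e'S : e' \in S by apply: (fintype.subsetP aS); rewrite inE ae'.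
suff ee' : e = e' by rewrite -ae' ee'.
apply: x_inj => //; apply: le_lt_trans (enorm_tri _ (b e) _) _.
have := edge_metric_edge hD b x e; have := edge_metric_edge hD a x e'.
by rewrite (enormB (x e)) ae'; lra.
Qed.

(** [phi y] is the only representative of [y] that is supported in [S] and within [r'] of [x]. It is
    found by moving [rep y] along the equivalence from a nearby member [x'] of the class of [x] to
    [x] itself. *)
Lemma flat_chart_exists : exists phi : Y -> X, flat_chart rho y0 r' S phi.
Proof.
have r'0 := r'_gt0; have [E' hE' xE'] := (rpreshapeP F x).1 Zx.
have SE' : S \subset E' by rewrite -xS.
have lift y : exists a, mball rho y0 r' y ->
    [/\ supp a \subset S, same_shape a (rep y) & d2 a x < r'].
  have [yr|] := pselect (mball rho y0 r' y); last by exists x.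
  have r'4 : r' <= 4 * r' by lra.
  have [x' x'x x'y] := shape_local hD hS x_gap r'4 xy0 (same_shape_refl (rep y)) yr.
  have supp_x'y : supp x' \subset supp (rep y).
    apply: (edge_gap_supp hD (same_shape_edge_gap x'x x_gap)); lra.
  (* Maximality: [rep y] contains the edges of [x'] and cannot have more of them. *)
  have supp_yx' : supp (rep y) \subset supp x'.
    rewrite -(eqP (_ : supp x' == supp (rep y)))// eqEcard supp_x'y.
    rewrite (same_shape_card x'x) xS; apply: (S_max (shape_rep hS y)) => //.
    exact: y0_sub.
  have [a [ax ay sums]] := same_shape_transport x'x supp_yx'.
  exists a => _; split=> //; first by rewrite -xS.
  by rewrite (edge_metric_sums hD sums) (edge_metricC hD).
have /choice [phi hphi] := lift.
have phi_y0 : phi y0 = x.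
  have [|_ hs hr] := hphi y0; first by rewrite /mball /= rho_xx.
  apply: (@chart_unique x); rewrite ?xS ?edge_metric_xx//; first by lra.
  exact: same_shape_trans hs (same_shape_sym xy0).
exists phi; split=> [y z /hphi[yS ys yx] /hphi[zS zs zx]|y /hphi[]//|w wS].
  apply/le_anti/andP; split.
    exact: (shape_flat hS hE' (fintype.subset_trans yS SE') (fintype.subset_trans zS SE')).
  (* A shorter quotient distance would yield a member [a] of the class of [phi y] nearer to [phi z].
     It lies within [2 * r' + r'] of [x], so [chart_unique] identifies it with [phi y]. The gap of
     [phi y] is [4 * r' - r'], just enough for [shape_local]. *)
  rewrite leNgt; apply/negP => lt_yz.
  have yz2 : d2 (phi y) (phi z) < 2 * r'.
    have := edge_metric_tri hD (phi y) x (phi z).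
    by rewrite (edge_metricC hD x); lra.
  have y_sep : edge_gap (3 * r') (phi y).
    move=> e ye; have eS : e \in S by apply: (fintype.subsetP yS); rewrite inE.
    have := x_sep eS; have := edge_metric_edge hD (phi y) x e.
    have := enorm_dist (phi y e) (x e); rewrite ler_norml => /andP[]; lra.
  have le3 : d2 (phi y) (phi z) <= 3 * r' by lra.
  have [a ay az] := shape_local hD hS y_sep le3 ys zs lt_yz.
  have : a = phi y.
    apply: chart_unique => //.
    by have := edge_metric_tri hD a (phi z) x; lra.
  by move=> ay_eq; move: az; rewrite ay_eq ltxx.
rewrite phi_y0 => xw.
have wE' := fintype.subset_trans wS SE'.
have Zw : rpreshape R d n F w by apply/rpreshapeP; exists E'.
have [y wy] := shape_onto hS Zw.
have yr : mball rho y0 r' y.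
  exact: le_lt_trans (shape_flat hS hE' xE' wE' xy0 wy) xw.
exists y => //; have [yS ys yx] := hphi y yr.
apply: chart_unique => //; [by rewrite (edge_metricC hD)|lra|].
exact: same_shape_trans ys (same_shape_sym wy).
Qed.

End Chart.

Lemma flat_charts_dense p r : 0 < r -> exists q r' S (phi : Y -> X),
  [/\ mball rho p r q, 0 < r' & flat_chart rho q r' S phi].
Proof.
move=> r0.
(* The maximum is taken over the given ball only, so the new centre may have fewer edges than
   [t]. *)
pose attained (m : nat) := `[< exists x y, [/\ rpreshape R d n F x,
  same_shape x (rep y), rho p y < r & #|supp x| = m] >].
have ex_attained : exists m, attained m.
  exists #|supp (rep p)|; apply/asboolP; exists (rep p), p; split=> //.
    exact: shape_rep hS p.
  by rewrite rho_xx.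
have ub_attained m : attained m -> (m <= #|edge t|)%N.
  by move=> /asboolP[x [y [_ _ _ <-]]]; exact: max_card.
case: (ex_maxnP ex_attained ub_attained) => m /asboolP [x1 [y1 [Zx1 x1y1 y1r <-]]] m_max.
have r1 : 0 < r - rho p y1 by rewrite subr_gt0.
have [x [x1x supp_x x_inj]] := perturb x1 r1.
have [E' hE' x1E'] := (rpreshapeP F x1).1 Zx1.
have xE' : supp x \subset E' by rewrite supp_x.
have Zx : rpreshape R d n F x by apply/rpreshapeP; exists E'.
have [y0 xy0] := shape_onto hS Zx.
have y0r : rho p y0 < r.
  have := shape_flat hS hE' x1E' xE' x1y1 xy0; have := rho_tri p y1 y0; lra.
have [e|ra [ra_gt0 ha]] := @positive_lower_bound R _ (fun e => e \in supp x)
  (fun e => enorm (x e)); first by rewrite inE; exact: enorm_gt0.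
have [[e e'] /= /and3P[he he' ee']|rb [rb_gt0 hb]] := @positive_lower_bound R _
    (fun u => [&& u.1 \in supp x, u.2 \in supp x & u.1 != u.2])
    (fun u => enorm (x u.1 - x u.2)).
  apply: enorm_gt0; rewrite subr_eq0; apply: contra ee' => /eqP xee'.
  by apply/eqP/x_inj; rewrite -?supp_x.
(* The first bound keeps the new ball where the number of edges is maximal; the second puts [4 * r']
   below the norms of the attributes and below their mutual distances. *)
pose r' := Num.min (r - rho p y0) (Num.min ra rb / 4).
have r'_gt0 : 0 < r' by rewrite lt_min subr_gt0 y0r divr_gt0// lt_min ra_gt0.
have r'_le : r' <= r - rho p y0 by rewrite ge_min lexx.
have r'4 : 4 * r' <= Num.min ra rb.
  by rewrite mulrC -ler_pdivlMr// ge_min lexx orbT.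
have supp_max a y : rpreshape R d n F a -> same_shape a (rep y) ->
    rho p y < r -> (#|supp a| <= #|supp x|)%N.
  by move=> Za ay yr; rewrite supp_x; apply: m_max; apply/asboolP; exists a, y.
have ball_sub y : rho y0 y < r' -> rho p y < r.
  by move=> yr; have := rho_tri p y0 y; lra.
have x_ge e : e \in supp x -> 4 * r' <= enorm (x e).
  by move=> xe; apply: le_trans r'4 _; rewrite ge_min ha.
have x_sep : {in supp x &, forall e e', enorm (x e - x e') < 4 * r' -> e = e'}.
  move=> e e' xe xe'; apply: contraTeq => ee'; rewrite -leNgt.
  by apply: le_trans r'4 _; rewrite ge_min (hb (e, e')) ?orbT//= xe xe'.
have [phi hphi] := flat_chart_exists supp_max Zx erefl xy0 r'_gt0 ball_sub x_ge x_sep.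
by exists y0, r', (supp x), phi.
Qed.

Lemma flat_charts_generic : generically_nonpositively_curved rho.
Proof.
exists [set q | exists r S (phi : Y -> X), 0 < r /\ flat_chart rho q r S phi]; split.
- move=> p [r [S [phi [r0 hphi]]]]; exists r; split=> // q qr.
  exists (r - rho p q), S, phi; split; first by rewrite subr_gt0.
  exact: flat_chart_sub.
- move=> p r /(flat_charts_dense p) [q [r' [S [phi [qr r'0 hphi]]]]].
  by exists q; split=> //; exists r', S, phi.
move=> p [r [S [phi [r0 hphi]]]]; exists r; split=> //.
exact: flat_chart_CAT hphi.
Qed.

End GenericChart.

Lemma edges_gt1 t : t <> Leaf -> (1 < #|[set: edge t]%SET|)%N.
Proof.
case: t => [//|l r] _; apply/card_gt1P.
by exists (inl None : edge (Node l r)), (inr None : edge (Node l r)); rewrite !inE.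
Qed.

Theorem theorem35 (R : realType) (d n : nat) (t : bintree)
    (hd : (0 < d)%N) (hn : (0 < n)%N) (ht : t <> Leaf) :
  let QED := ushape_dist (@d2 R d n t) in
  let TED := ushape_dist (@d1 R d n t) in
  (is_metric QED /\ generically_nonpositively_curved QED) /\
  (is_metric TED /\
   [/\ curvature_unbounded_everywhere TED,
       geodesics_nowhere_locally_unique TED,
       means_nowhere_locally_unique TED,
       centroids_nowhere_locally_unique TED &
       circumcenters_nowhere_locally_unique TED]) /\
  (forall F : {set {set edge t}},
     F != finset.set0 -> topology_closed F -> saturated F ->
     let QEDZ := rushape_dist F (@d2 R d n t) in
     let TEDZ := rushape_dist F (@d1 R d n t) in
     (is_metric QEDZ /\ generically_nonpositively_curved QEDZ) /\
     (is_metric TEDZ /\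
      ((exists2 E' : {set edge t}, E' \in F & (1 < #|E'|)%N) ->
       [/\ curvature_unbounded_everywhere TEDZ,
           geodesics_nowhere_locally_unique TEDZ,
           means_nowhere_locally_unique TEDZ,
           centroids_nowhere_locally_unique TEDZ &
           circumcenters_nowhere_locally_unique TEDZ]))).

Proof.
have hD1 := edge_metric_d1 R d n t; have hD2 := edge_metric_d2 R d n t.
have TED_case F (Y : Type) (rho : Y -> Y -> R) rep (E' : {set edge t}) :
    shape_space F (@d1 R d n t) rho rep -> E' \in F -> (1 < #|E'|)%N ->
    [/\ curvature_unbounded_everywhere rho, geodesics_nowhere_locally_unique rho,
        means_nowhere_locally_unique rho, centroids_nowhere_locally_unique rho &
        circumcenters_nowhere_locally_unique rho].
  move=> hS hE' E'_gt1; have rho_metric := shape_metric hD1 hS.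
  have bigons p r (r0 : 0 < r) := tree_edit_bigon hS hd hn p hE' E'_gt1 r0.
  split; [exact: bigons_curvature|exact: bigons_geodesics|exact: bigons_means|
    exact: bigons_centroids|exact: bigons_circumcenters].
split; [|split] => /=.
- have hS := shape_space_ushape hD2; split; first exact: shape_metric hD2 hS.
  exact: flat_charts_generic hS hd hn.
- have hS := shape_space_ushape hD1; split; first exact: shape_metric hD1 hS.
  by apply: (TED_case _ _ _ _ [set: edge t]%SET hS); rewrite ?inE// edges_gt1.
move=> F _ _ _; split.
  have hS := shape_space_rushape F hD2; split; first exact: shape_metric hD2 hS.
  exact: flat_charts_generic hS hd hn.
have hS := shape_space_rushape F hD1; split; first exact: shape_metric hD1 hS.
by move=> [E' hE' E'_gt1]; exact: TED_case hS hE' E'_gt1.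
Qed.
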